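(* Let $Q$ be a prime congruent to $3$, $5$ or $6$ modulo $7$. Then $\bar p(7Q^3n)\equiv 0 \pmod 7$ for all positive integers $n$ coprime to $Q$.
   Context: An overpartition of $n$ is a non-increasing sequence of positive integers with sum $n$ in which the first occurrence of each integer may be overlined. $\bar p(n)$ denotes the number of overpartitions of $n$ (with $\bar p(0)=1$); its generating function is $\sum_{n\ge 0}\bar p(n)q^n=\prod_{n\ge 1}\frac{1+q^n}{1-q^n}$. *)

(* Defs.v *)
From mathcomp Require Import all_boot.

Set Implicit Arguments.
Unset Strict Implicit.
Unset Printing Implicit Defensive.

(* An overpartition is a sequence of pairs (part, overlined?). The last
   clause says that an overlined part differs from every earlier part, i.e.
   is the first occurrence of its value. *)
Definition is_overpartition (n : nat) (s : seq (nat * bool)) : bool :=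
  [&& sorted geq (unzip1 s),
      all (ltn 0) (unzip1 s),
      sumn (unzip1 s) == n
    & pairwise [rel x y : nat * bool | y.2 ==> (x.1 != y.1)] s].

Definition forget_bound (n : nat) (s : seq ('I_n.+1 * bool)) : seq (nat * bool) :=
  [seq (val x.1, x.2) | x <- s].

(* Restricting to at most n parts, each at most n, loses nothing: see
   overpartition_bounded. *)
Definition overpartition_number (n : nat) : nat :=
  #|[set s : n.-bseq ('I_n.+1 * bool)%type
     | is_overpartition n (forget_bound s)]|.

Lemma overpartition_bounded (n : nat) (s : seq (nat * bool)) :
  is_overpartition n s ->
  exists t : n.-bseq ('I_n.+1 * bool)%type, forget_bound t = s.
Proof.
case/and4P=> _ pos /eqP sum_s _.
have le_size : size s <= n.
  rewrite -sum_s; elim: s pos {sum_s} => //= x s IHs /andP[x_gt0 /IHs le_s].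
  by rewrite -add1n leq_add.
have le_part x : x \in s -> x.1 <= n.
  rewrite -sum_s => /(map_f fst); rewrite -/(unzip1 s).
  elim: (unzip1 s) => //= y r IHr; rewrite inE => /orP[/eqP-> | /IHr le_x].
    exact: leq_addr.
  exact: leq_trans le_x (leq_addl _ _).
pose t := [seq (inord x.1 : 'I_n.+1, x.2) | x <- s].
have size_t : size t <= n by rewrite size_map.
exists (Bseq size_t); rewrite /forget_bound /= -map_comp.
rewrite -[RHS]map_id; apply/eq_in_map => -[x b] /le_part /= le_x.
by rewrite inordK.
Qed.

Lemma forget_bound_inj (n : nat) : injective (@forget_bound n).
Proof. by apply: inj_map => -[x b] [y c] /= [/val_inj-> ->]. Qed.

(* Main.v *)
Require Import Defs.
From mathcomp Require Import all_boot.
From HB Require Import structures.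
From mathcomp Require Import all_order all_algebra.
From mathcomp Require Import boolp.
From mathcomp Require Import zify ring.

(** Let [theta] be the series of [q^(u^2)], [u] an integer. Gauss's identity says
    that [w = 1 / theta] has coefficients [(-1)^n pbar(n)]. Modulo 7,
    [w = theta^6 w^7] and [w^7 = w(q^7)], so the coefficients of [w] at the
    multiples of 7 come from those of [theta^6]. Jacobi's formulas for sums of
    four and six squares then yield, for [n] not a square,
    [(-1)^n pbar(7 n) = 8 T(n)] modulo 7, where [T(n)] is the sum of [c(d, e) d]
    over the solutions of [u^2 + d e = n] with [d, e > 0] and [c] only depends on
    the parities of [d] and [e]. All three identities about [theta] reduce, by
    logarithmic differentiation, to sums over these solutions, which an
    involution of Liouville evaluates.

    Solutions of [u^2 + d e = n] are binary quadratic forms taking opposite signs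
    at [0] and infinity. Following Zagier, the sum of the positive values at a
    rational [r] of the forms negative at infinity does not depend on [r]; taking
    it over the images of the forms of determinant [Q m] under the [Q + 1]
    substitutions of determinant [Q] gives [T(Q^3 m) = (1 + Q^3) T(Q m)] for [m]
    prime to [Q], and [1 + Q^3] is divisible by 7 when [Q] is 3, 5 or 6 mod 7. *)

Set Implicit Arguments.
Unset Strict Implicit.
Unset Printing Implicit Defensive.
Import Order.TTheory GRing.Theory Num.Theory.
Local Open Scope ring_scope.

(** * Formal power series with integer coefficients *)

(** A wrapper, so that the ring product can be convolution. Equality of series is decidable only
    classically, whence the [boolp] mixins. *)
Record fps := Fps { cf :> nat -> int }.

HB.instance Definition _ := gen_eqMixin fps.
HB.instance Definition _ := gen_choiceMixin fps.

Lemma fpsP (f g : fps) : (forall n, f n = g n) <-> f = g.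
Proof.
split=> [fg | -> //].
by case: f g fg => f [g] fg; congr Fps; apply: funext.
Qed.

Definition fps_const (c : int) := Fps (fun n => if n == 0%N then c else 0).
Definition fps_add (f g : fps) := Fps (fun n => f n + g n).
Definition fps_opp (f : fps) := Fps (fun n => - f n).
Definition fps_mul (f g : fps) :=
  Fps (fun n => \sum_(i < n.+1) f i * g (n - i)%N).

Fact fps_addA : associative fps_add.
Proof. by move=> f g h; apply/fpsP => n /=; rewrite addrA. Qed.
Fact fps_addC : commutative fps_add.
Proof. by move=> f g; apply/fpsP => n /=; rewrite addrC. Qed.
Fact fps_add0 : left_id (fps_const 0) fps_add.
Proof. by move=> f; apply/fpsP => n /=; rewrite if_same add0r. Qed.
Fact fps_addN : left_inverse (fps_const 0) fps_opp fps_add.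
Proof. by move=> f; apply/fpsP => n /=; rewrite if_same addNr. Qed.

HB.instance Definition _ :=
  GRing.isZmodule.Build fps fps_addA fps_addC fps_add0 fps_addN.

Definition trunc N (f : fps) : {poly int} := \poly_(i < N) f i.

Lemma coef_trunc N f i : (i < N)%N -> (trunc N f)`_i = f i.
Proof. by move=> ltiN; rewrite coef_poly ltiN. Qed.

(** A coefficient of a product involves finitely many coefficients, so associativity and
    commutativity carry over from [{poly int}]. *)
Lemma fps_mul_trunc N f g n :
  (n < N)%N -> fps_mul f g n = (trunc N f * trunc N g)`_n.
Proof.
move=> ltnN; rewrite coefM; apply: eq_bigr => i _.
by rewrite !coef_trunc // (leq_ltn_trans _ ltnN) ?leq_subr // -ltnS.
Qed.

Fact fps_mulC : commutative fps_mul.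
Proof.
by move=> f g; apply/fpsP => n; rewrite !(@fps_mul_trunc n.+1) // mulrC.
Qed.

Fact fps_mulA : associative fps_mul.
Proof.
move=> f g h; apply/fpsP => n.
transitivity (trunc n.+1 f * (trunc n.+1 g * trunc n.+1 h))`_n.
  rewrite coefM; apply: eq_bigr => i _.
  by rewrite coef_trunc // -fps_mul_trunc // ltnS leq_subr.
rewrite mulrA coefM; apply: eq_bigr => i _.
by rewrite coef_trunc ?ltnS ?leq_subr // -fps_mul_trunc.
Qed.

Fact fps_mul1 : left_id (fps_const 1) fps_mul.
Proof.
move=> f; apply/fpsP => n /=; rewrite big_ord_recl /= mul1r subn0.
by rewrite big1 ?addr0 // => i _; rewrite mul0r.
Qed.

Fact fps_mulDl : left_distributive fps_mul +%R.
Proof.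
move=> f g h; apply/fpsP => n /=; rewrite -big_split; apply: eq_bigr => i _.
by rewrite mulrDl.
Qed.

Fact fps_1neq0 : fps_const 1 != 0.
Proof. by apply/eqP => /fpsP/(_ 0%N). Qed.

HB.instance Definition _ := GRing.Zmodule_isComNzRing.Build fps
  fps_mulA fps_mulC fps_mul1 fps_mulDl fps_1neq0.

Lemma cf0 n : (0 : fps) n = 0. Proof. by rewrite /= if_same. Qed.
Lemma cf1 n : (1 : fps) n = (n == 0%N)%:R.
Proof. by rewrite /GRing.one /=; case: (n == 0%N). Qed.
Lemma cfD (f g : fps) n : (f + g) n = f n + g n. Proof. by []. Qed.
Lemma cfN (f : fps) n : (- f) n = - f n. Proof. by []. Qed.
Lemma cfB (f g : fps) n : (f - g) n = f n - g n. Proof. by []. Qed.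
Lemma cfMn (f : fps) k n : (f *+ k) n = f n *+ k.
Proof. by elim: k => [|k IHk]; rewrite ?cf0 // !mulrS cfD IHk. Qed.
Lemma cfnM k (f : fps) n : (k%:R * f) n = k%:R * f n.
Proof. by rewrite !mulr_natl cfMn. Qed.
Lemma cfM (f g : fps) n : (f * g) n = \sum_(i < n.+1) f i * g (n - i)%N.
Proof. by []. Qed.
(** The derivation [q d/dq], which keeps every coefficient at its index. *)
Definition fps_D (f : fps) := Fps (fun n => n%:Z * f n).

Lemma fps_DM f g : fps_D (f * g) = fps_D f * g + f * fps_D g.
Proof.
apply/fpsP => n; rewrite cfD !cfM /= big_distrr -big_split /=.
apply: eq_bigr => i _; have le_in : (i <= n)%N by rewrite -ltnS.
have -> : n%:Z = i%:Z + (n - i)%N%:Z by lia.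
ring.
Qed.

Lemma fps_DD f g : fps_D (f + g) = fps_D f + fps_D g.
Proof. by apply/fpsP => n; rewrite /= mulrDr. Qed.

Lemma fps_DN f : fps_D (- f) = - fps_D f.
Proof. by apply/fpsP => n; rewrite /= mulrN. Qed.

Lemma fps_D1 : fps_D 1 = 0.
Proof. by apply/fpsP => -[|n] /=; rewrite ?cf1 ?mulr0 // mul0r. Qed.

Lemma fps_D_eq0 f : fps_D f = 0 -> f = fps_const (f 0%N).
Proof.
move=> Df0; apply/fpsP => -[|n] //=.
have /fpsP/(_ n.+1) := Df0; rewrite cf0 /= => /eqP.
by rewrite mulf_eq0 /= => /eqP.
Qed.

(** The monomial [q^m]. *)
Definition fps_X m := Fps (fun n => (n == m)%:R).

Lemma cfXM m (f : fps) n : (fps_X m * f) n = if (m <= n)%N then f (n - m)%N else 0.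
Proof.
rewrite cfM; case: leqP => [le_mn|lt_nm].
  rewrite (bigD1 (inord m)) //= inordK // eqxx mul1r big1 ?addr0 // => i.
  by rewrite -val_eqE /= inordK // => /negPf->; rewrite mul0r.
rewrite big1 // => i _ /=; case: eqP => [im|]; last by rewrite mul0r.
by have := ltn_ord i; rewrite im ltnS leqNgt lt_nm.
Qed.

Lemma fps_DX m : fps_D (fps_X m) = m%:R * fps_X m.
Proof.
by apply/fpsP => n; rewrite cfnM (natz m) /=; case: eqP => [->|_]; rewrite ?mulr0.
Qed.

(** * Theta series, Lambert series and the equation [u^2 + d e = n] *)

Lemma sum_bij (V : nmodType) (T1 T2 : eqType) (s1 : seq T1) (s2 : seq T2)
    (f : T1 -> T2) (g : T2 -> T1) (F : T2 -> V) :
    uniq s1 -> uniq s2 ->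
    (forall x, x \in s1 -> f x \in s2 /\ g (f x) = x) ->
    (forall y, y \in s2 -> g y \in s1 /\ f (g y) = y) ->
  \sum_(y <- s2) F y = \sum_(x <- s1) F (f x).
Proof.
move=> uniq1 uniq2 fP gP; rewrite -(big_map f xpredT F); apply: perm_big.
apply: uniq_perm => // [|y].
  rewrite map_inj_in_uniq // => x y /fP[_ {2}<-] /fP[_ {2}<-].
  by move=> ->.
apply/idP/mapP => [/gP[gy <-]|[x /fP[fx _] ->] //].
by exists (g y).
Qed.

Lemma leq_sqr k : (k <= k ^ 2)%N.
Proof. by case: k => // k; rewrite -mulnn leq_pmulr. Qed.

(** By [leq_sqr], this range is wide enough to contain every [u] with [u^2 <= n]. *)
Definition zrange (n : nat) : seq int :=
  [seq i%:Z - n%:Z | i <- iota 0 n.*2.+1].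

Arguments zrange : simpl never.

Lemma mem_zrange n (u : int) : (u \in zrange n) = (`|u| <= n)%N.
Proof.
apply/mapP/idP => [[i] | le_un]; first by rewrite mem_iota => ? ->; lia.
by exists (absz (u + n%:Z)); rewrite ?mem_iota; lia.
Qed.

Lemma zrange_uniq n : uniq (zrange n).
Proof. by rewrite map_inj_uniq ?iota_uniq // => i j; lia. Qed.

Definition theta :=
  Fps (fun n => \sum_(u <- zrange n | (`|u| ^ 2 == n)%N) 1).

(** The factor [phi] covers both [theta] and, for [phi i = i], its derivative. *)
Lemma theta_mul (phi : nat -> int) (f : fps) n :
  (Fps (fun i => phi i * theta i) * f) n =
  \sum_(u <- zrange n | (`|u| ^ 2 <= n)%N)
     phi (`|u| ^ 2)%N * f (n - `|u| ^ 2)%N.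
Proof.
rewrite cfM.
pose F i u := if (`|u| ^ 2 == i)%N then phi i * f (n - i)%N else 0.
transitivity (\sum_(i < n.+1) \sum_(u <- zrange n) F (val i) u).
  apply: eq_bigr => -[i] /=; rewrite ltnS => le_in _.
  rewrite mulr_sumr mulr_suml -[RHS]big_mkcond -[LHS]big_filter -[RHS]big_filter.
  under eq_bigr do rewrite mulr1.
  apply: perm_big; apply: uniq_perm; rewrite ?filter_uniq ?zrange_uniq // => u.
  rewrite !mem_filter !mem_zrange; case: eqP => //= u2.
  have : (`|u| <= i)%N by rewrite -u2 leq_sqr.
  by move=> le_ui; rewrite le_ui (leq_trans le_ui).
rewrite exchange_big [RHS]big_mkcond; apply: eq_bigr => u _ /=.
case: leqP => [le_un|lt_nu].
  rewrite (bigD1 (inord (`|u| ^ 2))) //= /F inordK // eqxx big1 ?addr0 // => i.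
  rewrite -val_eqE /= inordK // eq_sym; case: eqP => //.
rewrite big1 // => -[i lt_in] _; rewrite /F /=; case: eqP => // ui; lia.
Qed.

Lemma theta_mulE (f : fps) n :
  (theta * f) n =
  \sum_(u <- zrange n | (`|u| ^ 2 <= n)%N) f (n - `|u| ^ 2)%N.
Proof.
rewrite (_ : theta = Fps (fun i => 1 * theta i)).
  by rewrite theta_mul; apply: eq_bigr => u _; rewrite mul1r.
by apply/fpsP => i /=; rewrite mul1r.
Qed.

Definition divisor_pairs (m : nat) : seq (int * int) :=
  [seq (d%:Z, (m %/ d)%N%:Z) | d <- iota 1 m & (d %| m)%N].

Lemma mem_divisor_pairs m (d e : int) :
  ((d, e) \in divisor_pairs m) = [&& 0 < d, 0 < e & d * e == m%:Z].
Proof.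
apply/mapP/idP => [[k]|].
  rewrite mem_filter mem_iota add1n ltnS => /and3P[k_m k0 le_km] [-> ->].
  by rewrite !ltz_nat k0 divn_gt0 // le_km -PoszM eqz_nat mulnC divnK //=.
case: d e => [d|d] [e|e] /and3P[] //; rewrite !ltz_nat => d0 e0.
rewrite -PoszM eqz_nat => /eqP <-; exists d; last by rewrite mulKn.
by rewrite mem_filter mem_iota dvdn_mulr //= d0 add1n ltnS leq_pmulr.
Qed.

Lemma divisor_pairs_uniq m : uniq (divisor_pairs m).
Proof.
by rewrite map_inj_uniq ?filter_uniq ?iota_uniq // => i j [].
Qed.

(** The Lambert series with terms [g d e q^(d e)] for [d, e > 0]. *)
Definition lambert (g : int -> int -> int) :=
  Fps (fun m => \sum_(x <- divisor_pairs m) g x.1 x.2).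

Lemma lambert0 g : lambert g 0%N = 0.
Proof. by rewrite /= big_nil. Qed.

Definition triples (n : nat) : seq (int * int * int) :=
  [seq (u, x.1, x.2) | u <- [seq u <- zrange n | (`|u| ^ 2 <= n)%N],
                       x <- divisor_pairs (n - `|u| ^ 2)].

Lemma mem_triples n (u d e : int) :
  ((u, d, e) \in triples n) = [&& 0 < d, 0 < e & u ^+ 2 + d * e == n%:Z].
Proof.
apply/allpairsPdep/idP => [[v [[d' e']]] | /and3P[d0 e0 /eqP eq_n]].
  rewrite mem_filter mem_zrange mem_divisor_pairs.
  case=> /andP[le_vn _] /and3P[d0 e0 /eqP eq_n] [-> -> ->] /=.
  by rewrite d0 e0 eq_n; apply/eqP; lia.
exists u, (d, e); rewrite mem_filter mem_zrange mem_divisor_pairs d0 e0.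
have de0 : 0 < d * e by rewrite mulr_gt0.
have u2 : (`|u| ^ 2)%N%:Z = u ^+ 2 by lia.
have le_un : (`|u| ^ 2 <= n)%N by rewrite -lez_nat u2 -eq_n lerDl ltW.
split=> //; first by rewrite le_un (leq_trans (leq_sqr _)).
by rewrite -subzn // -eq_n u2; apply/eqP; ring.
Qed.

Lemma triples_uniq n : uniq (triples n).
Proof.
apply: allpairs_uniq_dep.
- by rewrite filter_uniq ?zrange_uniq.
- by move=> u _; apply: divisor_pairs_uniq.
by move=> [u [d e]] [u' [d' e']] _ _ /= [-> -> ->].
Qed.

Definition tsum (n : nat) (h : int -> int -> int -> int) : int :=
  \sum_(t <- triples n) h t.1.1 t.1.2 t.2.

Lemma theta_lambert (phi : nat -> int) g n :
  (Fps (fun i => phi i * theta i) * lambert g) n =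
  tsum n (fun u d e => phi (`|u| ^ 2)%N * g d e).
Proof.
rewrite theta_mul /tsum /triples big_allpairs_dep big_filter.
by apply: eq_bigr => u _; rewrite mulr_sumr.
Qed.
(** * Liouville's involution *)

Section Involution.

Variables (n : nat) (h : int -> int -> int -> int).

(* [(u, d, e) -> (- u, e, d)] exchanges the halves [e > 2 u + d] and
   [e < 2 u + d], and [(u, d, e) -> (- u - d, d, e - 2 u - d)] is an involution of
   the first half; only the boundary [e = 2 u + d] survives. *)
Lemma liouville_involution :
    (forall u d e, h u d e + h (- u) e d
       + h (- u - d) d (e - 2 * u - d) + h (u + d) (e - 2 * u - d) d = 0) ->
  tsum n h =
  \sum_(t <- triples n | t.2 == 2 * t.1.1 + t.1.2) h t.1.1 t.1.2 t.2.
Proof.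
move=> h_eq.
pose h' (t : int * int * int) := h t.1.1 t.1.2 t.2.
pose s1 := [seq t <- triples n | 2 * t.1.1 + t.1.2 < t.2].
pose s2 := [seq t <- triples n | t.2 < 2 * t.1.1 + t.1.2].
have us1 : uniq s1 by rewrite filter_uniq ?triples_uniq.
have us2 : uniq s2 by rewrite filter_uniq ?triples_uniq.
have mem1 (u d e : int) : ((u, d, e) \in s1) =
    [&& 2 * u + d < e, 0 < d, 0 < e & u ^+ 2 + d * e == n%:Z].
  by rewrite mem_filter mem_triples.
have mem2 (u d e : int) : ((u, d, e) \in s2) =
    [&& e < 2 * u + d, 0 < d, 0 < e & u ^+ 2 + d * e == n%:Z].
  by rewrite mem_filter mem_triples.
have -> : tsum n h = \sum_(t <- s1) h' t + \sum_(t <- s2) h' t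
    + \sum_(t <- triples n | t.2 == 2 * t.1.1 + t.1.2) h' t.
  rewrite /tsum !big_filter !(big_mkcond (fun t => _ _ _)) -!big_split /=.
  apply: eq_bigr => t _; rewrite -/(h' t).
  by case: (ltgtP t.2 (2 * t.1.1 + t.1.2)); rewrite ?addr0 ?add0r.
rewrite (sum_bij (s1 := s1) (s2 := s2) (f := fun t => (- t.1.1, t.2, t.1.2))
  (g := fun t => (- t.1.1, t.2, t.1.2))) //; first last.
- move=> [[u d] e]; rewrite mem1 mem2 /= opprK sqrrN (mulrC e) => /and4P[? -> -> ->].
  by split=> //=; rewrite !andbT; lia.
- move=> [[u d] e]; rewrite mem1 mem2 /= opprK sqrrN (mulrC e) => /and4P[? -> -> ->].
  by split=> //=; rewrite !andbT; lia.
rewrite -big_split /=.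
set S := \sum_(t <- s1) _.
(* The summand of [S] plus its image under [psi] is the left side of [h_eq], hence zero. *)
suff : S = - S by rewrite -/(tsum n h) => ?; rewrite (_ : S = 0) ?add0r //; lia.
pose psi (t : int * int * int) : int * int * int :=
  (- t.1.1 - t.1.2, t.1.2, t.2 - 2 * t.1.1 - t.1.2).
have psiP t : t \in s1 -> psi t \in s1 /\ psi (psi t) = t.
  case: t => [[u d] e]; rewrite mem1 => /and4P[? ? ? /eqP eq_n].
  split; last by rewrite /psi /=; congr (_, _, _); ring.
  rewrite /psi mem1 /=; apply/and4P; split; [lia | lia | lia |].
  by rewrite -eq_n; apply/eqP; ring.
rewrite {1}/S (sum_bij _ us1 us1 psiP psiP) -sumrN; apply: eq_bigr => t _ /=.
apply/eqP; rewrite -addr_eq0 -(h_eq t.1.1 t.1.2 t.2) /h' /=.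
rewrite (_ : - (- t.1.1 - t.1.2) = t.1.1 + t.1.2); last by ring.
by apply/eqP; ring.
Qed.

(** On the boundary, [u^2 + d e = (u + d)^2]. *)
Lemma boundary_nonsquare :
    (forall l : int, l ^+ 2 <> n%:Z) ->
  \sum_(t <- triples n | t.2 == 2 * t.1.1 + t.1.2) h t.1.1 t.1.2 t.2 = 0.
Proof.
move=> nsq; rewrite -big_filter big1_seq //= => -[[u d] e].
rewrite mem_filter mem_triples /= => /and4P[/eqP-> _ _ /eqP eq_n].
by case: (nsq (u + d)); rewrite -eq_n; ring.
Qed.

(** Here [u + d = l], the root [- l] giving a negative [e]; positivity of [e = 2 l - d] leaves
    [0 < d < 2 l]. *)
Lemma boundary_square (l : nat) :
    n = (l ^ 2)%N ->
  \sum_(t <- triples n | t.2 == 2 * t.1.1 + t.1.2) h t.1.1 t.1.2 t.2 =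
  \sum_(1 <= d < l.*2) h (l%:Z - d%:Z) d%:Z ((2 * l)%:Z - d%:Z).
Proof.
move=> n_l; rewrite -[LHS]big_filter.
pose g (t : int * int * int) := `|t.1.2|%N.
pose f (d : nat) : int * int * int := (l%:Z - d%:Z, d%:Z, (2 * l)%:Z - d%:Z).
rewrite (sum_bij (s1 := index_iota 1 l.*2) (f := f) (g := g)) //=.
- exact: iota_uniq.
- by rewrite filter_uniq ?triples_uniq.
- move=> d; rewrite mem_index_iota => dP; split=> //.
  rewrite mem_filter mem_triples n_l /=.
  apply/and4P; split; [lia | lia | lia |].
  by apply/eqP; rewrite PoszM; ring.
move=> [[u d] e]; rewrite mem_filter mem_triples n_l /=.
case/and4P=> /eqP e_ud d0 e0 /eqP; rewrite e_ud.
have -> : u ^+ 2 + d * (2 * u + d) = (u + d) ^+ 2 by ring.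
rewrite -[(l ^ 2)%N%:Z]/(l ^ 2)%:Z PoszM -expr2 => /eqP.
rewrite eqf_sqr => /orP[]/eqP ud; last by lia.
rewrite mem_index_iota /g /f /=; split; first by lia.
by rewrite (_ : `|d|%N%:Z = d); [congr (_, _, _); lia | lia].
Qed.

End Involution.

(** * Parity weights and three evaluations by the involution *)

Definition oddz (x : int) := odd `|x|.

Lemma oddzD x y : oddz (x + y) = oddz x (+) oddz y.
Proof. rewrite /oddz; lia. Qed.
Lemma oddzN x : oddz (- x) = oddz x.
Proof. by rewrite /oddz abszN. Qed.
Lemma oddzM x y : oddz (x * y) = oddz x && oddz y.
Proof. by rewrite /oddz abszM oddM. Qed.
Lemma oddz2M x : oddz (2 * x) = false.
Proof. by rewrite oddzM. Qed.

(** The non-trivial Dirichlet character modulo 4. *)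
Definition quad_char (x : int) : int :=
  if (x %% 4)%Z == 1 then 1 else if (x %% 4)%Z == 3 then -1 else 0.

(** The weight in Jacobi's four-square formula, see [theta4]. *)
Definition c4 (d e : int) : int := if oddz d || oddz e then 1 else -1.

Lemma tsumD n h k :
  tsum n (fun u d e => h u d e + k u d e) = tsum n h + tsum n k.
Proof. exact: big_split. Qed.

Lemma tsumZ n c h : tsum n (fun u d e => c * h u d e) = c * tsum n h.
Proof. by rewrite /tsum mulr_sumr. Qed.

Lemma tsum_neg n h : tsum n h = tsum n (fun u d e => h (- u) d e).
Proof.
have neg_triples t :
    t \in triples n -> ((- t.1.1, t.1.2, t.2) \in triples n) /\
                        (- - t.1.1, t.1.2, t.2) = t.
  by case: t => [[u d] e]; rewrite !mem_triples sqrrN opprK.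
exact: (sum_bij _ (triples_uniq n) (triples_uniq n) neg_triples neg_triples).
Qed.

Lemma tsum_swap n h : tsum n h = tsum n (fun u d e => h u e d).
Proof.
have swap_triples t :
    t \in triples n -> ((t.1.1, t.2, t.1.2) \in triples n) /\
                        (t.1.1, t.1.2, t.2) = t.
  by case: t => [[u d] e]; rewrite !mem_triples mulrC => /and3P[-> -> ->].
exact: (sum_bij _ (triples_uniq n) (triples_uniq n) swap_triples swap_triples).
Qed.

Lemma tsum_odd n h : (forall u d e, h (- u) d e = - h u d e) -> tsum n h = 0.
Proof.
move=> h_odd; have : tsum n h = - tsum n h.
  rewrite {1}tsum_neg /tsum -sumrN; apply: eq_bigr => t _; exact: h_odd.
lia.
Qed.

Lemma eq_tsum n h k : (forall u d e, h u d e = k u d e) -> tsum n h = tsum n k.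
Proof. by move=> hk; apply: eq_bigr => t _; apply: hk. Qed.

Lemma sqrtz_dec (n : nat) :
  {l : nat | n = (l ^ 2)%N} + (forall l : int, l ^+ 2 <> n%:Z).
Proof.
have [/existsP/sigW[l /eqP ln]|/existsPn nsq] :=
    boolP [exists l : 'I_n.+1, n == (l ^ 2)%N].
  by left; exists l.
right=> l ln; have ln' : (`|l| ^ 2)%N = n by lia.
have ltl : (`|l| < n.+1)%N by rewrite ltnS -ln' leq_sqr.
by have := nsq (Ordinal ltl); rewrite /= ln' eqxx.
Qed.

Lemma theta_nonsquare n : (forall l : int, l ^+ 2 <> n%:Z) -> theta n = 0.
Proof.
move=> nsq; rewrite /= big1 // => u /eqP un; case: (nsq u); lia.
Qed.

Lemma theta_square l : (0 < l)%N -> theta (l ^ 2)%N = 2.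
Proof.
move=> l0; rewrite /= -big_filter.
rewrite (perm_big [:: l%:Z; - l%:Z]) ?big_cons ?big_nil //.
apply: uniq_perm; rewrite ?filter_uniq ?zrange_uniq //.
  by rewrite cons_uniq inE andbT; lia.
move=> u; rewrite mem_filter mem_zrange !inE eqn_exp2r //.
have le_l := leq_sqr l.
by case: eqP => ul /=; [rewrite ul le_l|]; lia.
Qed.

Lemma boundary_odd (l : nat) (F : nat -> int) :
    (forall d, ~~ odd d -> F d = 0) ->
  \sum_(1 <= d < l.*2) F d = \sum_(i < l) F i.*2.+1.
Proof.
move=> F0; elim: l => [|[|l] IHl]; first by rewrite big_ord0 big_geq.
  by rewrite big_ord1 /= big_nat1.
rewrite big_ord_recr -IHl /= doubleS big_nat_recr //= big_nat_recr //=.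
by rewrite [F l.*2.+2]F0 ?addr0 //= odd_double.
Qed.

(* In the next three lemmas, the second summand of [h] is odd in [u], hence does
   not contribute to the sum; it was found by solving the linear system that the
   hypothesis of [liouville_involution] imposes on it. *)
Lemma tsum_gauss n :
  tsum n (fun u d e => (if oddz e then 2 * (-1) ^+ oddz d * d else 0))
    = - n%:Z * theta n.
Proof.
pose h u d e : int := (if oddz e then (-1) ^+ oddz d * d else 0)
  + (if oddz d && ~~ oddz e then -2 * u else 0).
have -> : tsum n (fun u d e => if oddz e then 2 * (-1) ^+ oddz d * d else 0)
    = 2 * tsum n h.
  rewrite [tsum n h]tsumD [tsum n (fun u d e => if _ && _ then _ else _)]tsum_odd.
    by rewrite addr0 -tsumZ; apply: eq_tsum => u d e; case: ifP => _; ring.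
  by move=> u d e; case: ifP => _; rewrite ?oppr0 // mulrN.
rewrite liouville_involution => [|u d e]; last first.
  rewrite /h !(oddzD, oddzN, oddz2M) /=.
  by case: (oddz d) (oddz e) => [] []; rewrite /=; ring.
have [[l ->]|nsq] := sqrtz_dec n; last first.
  by rewrite theta_nonsquare // boundary_nonsquare // !mulr0.
rewrite (@boundary_square _ _ l) //.
case: l => [|l]; first by rewrite big_geq // mul0r.
(* For even [d], [e = 2 l - d] is even too and both summands of [h] vanish. *)
rewrite theta_square // boundary_odd => [|d]; last first.
  by rewrite /h oddzD oddzN PoszM oddz2M /oddz /= => /negPf ->; rewrite addr0.
set L : int := l.+1; have -> : ((l.+1 ^ 2)%N)%:Z = L * L by rewrite -mulnn PoszM.
suff -> : \sum_(i < l.+1) h (L - i.*2.+1%:Z) i.*2.+1 ((2 * l.+1)%:Z - i.*2.+1%:Z)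
  = - (L * L) by ring.
transitivity (\sum_(i < l.+1) - i.*2.+1%:Z).
  apply: eq_bigr => i _; rewrite /h oddzD oddzN PoszM oddz2M /=.
  by rewrite /oddz /= odd_double /= addr0 expr1 mulN1r.
rewrite /L; elim: (l.+1) => [|m IHm]; first by rewrite big_ord0.
by rewrite big_ord_recr IHm /= -addn1 -muln2 !PoszD !PoszM; ring.
Qed.

Lemma tsum_four n :
  tsum n (fun u d e => (d * e - 4 * u ^+ 2) * (8 * c4 d e * d))
    = 4 * (n%:Z * theta n).
Proof.
pose h u d e : int := c4 d e * ((d * e - 4 * u ^+ 2) * d)
  + - c4 d e * u * (d ^+ 2 - e ^+ 2).
have -> : tsum n (fun u d e => (d * e - 4 * u ^+ 2) * (8 * c4 d e * d))
    = 8 * tsum n h.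
  rewrite [tsum n h]tsumD [tsum n (fun u d e => - _ * _ * _)]tsum_odd.
    by rewrite addr0 -tsumZ; apply: eq_tsum => u d e; ring.
  by move=> u d e; ring.
rewrite liouville_involution => [|u d e]; last first.
  rewrite /h /c4 !(oddzD, oddzN, oddz2M) /=.
  by case: (oddz d) (oddz e) => [] []; rewrite /=; ring.
have [[l ->]|nsq] := sqrtz_dec n; last first.
  by rewrite theta_nonsquare // boundary_nonsquare // !mulr0.
rewrite (@boundary_square _ _ l) //.
case: l => [|l]; first by rewrite big_geq // mul0r !mulr0.
rewrite theta_square //.
set L : int := l.+1; have -> : ((l.+1 ^ 2)%N)%:Z = L * L by rewrite -mulnn PoszM.
suff S : \sum_(1 <= d < l.+1.*2) h (L - d%:Z) d ((2 * l.+1)%:Z - d%:Z)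
  = L * L by rewrite S; ring.
have E2 : (2 * l.+1)%N%:Z = 2 * L by rewrite PoszM.
(* On the boundary [d] and [e] have the same parity, so [c4] alternates in sign with [d]. The
   partial sums are then a constant minus [(-1)^m] times a polynomial in [m]; [q] is 16 times that
   polynomial, in the variable [2 L - 2 m - 1]. *)
pose q (x : int) := 8 * L ^+ 3 - 4 * L ^+ 2 * x - 2 * L * (x ^+ 2 - 1)
  + 5 * x ^+ 3 - 15 * x.
have partial m :
    16 * \sum_(1 <= d < m.+1) h (L - d%:Z) d ((2 * l.+1)%:Z - d%:Z)
    = q (2 * L - 1) - (-1) ^+ m * q (2 * L - 2 * m%:Z - 1).
  elim: m => [|m IHm]; first by rewrite big_geq // /q; ring.
  rewrite big_nat_recr // mulrDr IHm /h /c4 E2 oddzD oddz2M oddzN.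
  rewrite (_ : oddz m.+1 = ~~ odd m) // orbb [_ ^+ m.+1]exprS -[(-1) ^+ m]signr_odd intS /q.
  by case: (odd m); rewrite ?expr0 ?expr1 /=; ring.
have S := partial l.*2.+1; rewrite -doubleS in S.
(* At [m = 2 L - 1] the two arguments of [q] are opposite: its odd part cancels and [16 L^2]
   remains. *)
apply: (@mulfI _ 16) => //; rewrite S.
have -> : l.*2.+1%:Z = 2 * L - 1 by rewrite /L; lia.
rewrite exprS -mul2n exprM sqrrN !expr1n /q; ring.
Qed.

Lemma tsum_six n :
  tsum n (fun u d e => (d * e - 6 * u ^+ 2)
                        * (quad_char d * (16 * e ^+ 2 - 4 * d ^+ 2)))
    = 6 * (n%:Z * theta n).
Proof.
(* As [tau] depends only on [u] modulo 2 and [e] modulo 4, the identity required of [h] is a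
   polynomial one for each parity of [u] and each pair of residues of [d] and [e] modulo 4. *)
pose tau u e : int := if (e %% 4)%Z == 0 then (-1) ^+ oddz u
  else if (e %% 4)%Z == 2 then - (-1) ^+ oddz u else 0.
pose h u d e : int := quad_char d * ((d * e - 6 * u ^+ 2) * (4 * e ^+ 2 - d ^+ 2))
  + quad_char d * u * (8 * e ^+ 3 - 12 * d * e ^+ 2 - 6 * d ^+ 2 * e + d ^+ 3
      + 16 * u ^+ 2 * e + 8 * u ^+ 2 * d
      + tau u e * (d + e) * ((d + e) ^+ 2 - 4 * u ^+ 2)).
have -> : tsum n (fun u d e => (d * e - 6 * u ^+ 2)
    * (quad_char d * (16 * e ^+ 2 - 4 * d ^+ 2))) = 4 * tsum n h.
  rewrite [tsum n h]tsumD [tsum n (fun u d e => _ * u * _)]tsum_odd.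
    by rewrite addr0 -tsumZ; apply: eq_tsum => u d e; ring.
  by move=> u d e; rewrite /tau oddzN; ring.
rewrite liouville_involution => [|u d e]; last first.
  have res4 x : {i : 'I_4 | (x %% 4)%Z = i}.
    have lt_x4 : (`|(x %% 4)%Z| < 4)%N by lia.
    by exists (Ordinal lt_x4) => /=; lia.
  have Ee : ((e - 2 * u - d) %% 4)%Z
      = (((e %% 4)%Z - 2 * (oddz u : nat)%:Z - (d %% 4)%Z) %% 4)%Z.
    by rewrite /oddz; lia.
  have Ed : oddz d = oddz (d %% 4)%Z by rewrite /oddz; lia.
  rewrite /h /tau /quad_char Ee !(oddzD, oddzN) Ed.
  have [i ->] := res4 d; have [j ->] := res4 e.
  by case: (oddz u) i j => [] [[|[|[|[|//]]]] ?] [[|[|[|[|//]]]] ?] /=; ring.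
have [[l ->]|nsq] := sqrtz_dec n; last first.
  by rewrite theta_nonsquare // boundary_nonsquare // !mulr0.
rewrite (@boundary_square _ _ l) //.
case: l => [|l]; first by rewrite big_geq // mul0r !mulr0.
rewrite theta_square // boundary_odd => [|d]; last first.
  move=> d_even; rewrite /h (_ : quad_char d = 0) ?mul0r ?addr0 // /quad_char.
  rewrite (_ : (_ == 1) = false); last by lia.
  by rewrite (_ : (_ == 3) = false); last by lia.
set L : int := l.+1; have -> : ((l.+1 ^ 2)%N)%:Z = L * L by rewrite -mulnn PoszM.
suff S : \sum_(i < l.+1) h (L - i.*2.+1%:Z) i.*2.+1 ((2 * l.+1)%:Z - i.*2.+1%:Z)
  = 3 * (L * L) by rewrite S; ring.
have E2 : (2 * l.+1)%N%:Z = 2 * L by rewrite PoszM.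
(* For [d = 2 m + 1], [e] is odd, so [tau] vanishes, and [quad_char d = (-1)^m]; [r] is the
   polynomial that makes this alternating sum telescope. *)
pose r (x : int) := L * (x ^+ 3 - 3 * x - 6 * L * (x ^+ 2 - 1) + 8 * L ^+ 2 * x).
have partial m :
    2 * \sum_(i < m) h (L - i.*2.+1%:Z) i.*2.+1 ((2 * l.+1)%:Z - i.*2.+1%:Z)
    = r 0 - (-1) ^+ m * r m.*2%:Z.
  elim: m => [|m IHm]; first by rewrite big_ord0 double0 /r; ring.
  rewrite big_ord_recr mulrDr IHm -[nat_of_ord ord_max]/m /h E2 [_ ^+ m.+1]exprS.
  have Em : m.*2.+1%:Z = 2 * m%:Z + 1 by lia.
  rewrite (_ : tau _ _ = 0); last first.
    by rewrite /tau !ifF //; rewrite /L; lia.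
  rewrite (_ : quad_char _ = (-1) ^+ m); last first.
    rewrite -signr_odd /quad_char; case: (boolP (odd m)) => [m_odd|m_even].
      by rewrite ifF ?ifT //; lia.
    by rewrite ifT //; lia.
  have -> : m.+1.*2%:Z = 2 * m%:Z + 2 by lia.
  have -> : m.*2%:Z = 2 * m%:Z by lia.
  by rewrite Em /r; ring.
(* [r] vanishes at [2 L], so only [r 0 = 6 L^2] is left. *)
apply: (@mulfI _ 2) => //; rewrite partial -mul2n PoszM -/L /r; ring.
Qed.
(** * The generating function of overpartitions *)

Lemma is_overpartition_cons n a b s :
  is_overpartition n ((a, b) :: s) =
  [&& (0 < a)%N, (a <= n)%N, is_overpartition (n - a) s,
      all (geq a) (unzip1 s) & (a, true) \notin s].
Proof.
rewrite /is_overpartition /= path_sortedE; last by move=> x y z /= ? ?; lia.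
have -> : all [pred y : nat * bool | y.2 ==> (a != y.1)] s = ((a, true) \notin s).
  rewrite -has_pred1 -all_predC; apply: eq_all => -[x [|]] /=.
    by rewrite xpair_eqE andbT eq_sym.
  by rewrite xpair_eqE andbF.
have -> : (a + sumn (unzip1 s) == n)%N = (a <= n)%N && (sumn (unzip1 s) == n - a)%N.
  by lia.
case: (0 < a)%N => //=; last by rewrite andbF.
case: (a <= n)%N => //=; last by rewrite !andbF.
case: (all (geq a) _) => /=; last by rewrite !andbF.
case: (_ \notin _) => /=; last by rewrite !andbF.
by rewrite andbT.
Qed.

Lemma mem_map_cons (T : eqType) (x y : T) (s : seq T) (l : seq (seq T)) :
  (x :: s \in [seq y :: t | t <- l]) = (x == y) && (s \in l).
Proof.
apply/mapP/andP => [[t t_l [-> ->]]|[/eqP -> s_l]]; first by rewrite eqxx.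
by exists s.
Qed.

Lemma mem_map_nil (T : eqType) (y : T) (l : seq (seq T)) :
  ([::] \in [seq y :: t | t <- l]) = false.
Proof. by apply/mapP => -[]. Qed.

Section Enumeration.

Variables (m : nat) (E : nat -> seq (seq (nat * bool))).

(** [E n] stands for the overpartitions of [n] with parts below [m]; plain copies of [m] are put in
    front. The fuel [k] bounds their number, and [k >= n] suffices for [m > 0]. *)
Fixpoint add_plain (k n : nat) : seq (seq (nat * bool)) :=
  E n ++ if k is k'.+1 then
    if (m <= n)%N then [seq (m, false) :: s | s <- add_plain k' (n - m)] else [::]
  else [::].

(** Only the first copy of [m] may be overlined: it comes in two versions, followed by plain
    copies. *)
Definition add_parts (n : nat) : seq (seq (nat * bool)) :=
  E n ++ if (m <= n)%N then
    [seq (m, false) :: s | s <- add_plain n (n - m)] ++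
    [seq (m, true) :: s | s <- add_plain n (n - m)]
  else [::].

End Enumeration.

Fixpoint overpartitions_le (m n : nat) : seq (seq (nat * bool)) :=
  if m is m'.+1 then add_parts m (overpartitions_le m') n
  else if n == 0%N then [:: [::]] else [::].

Definition parts_le (m : nat) (s : seq (nat * bool)) := all (geq m) (unzip1 s).

Section Membership.

Variables (m : nat) (E : nat -> seq (seq (nat * bool))).
Hypothesis E_uniq : forall n, uniq (E n).
Hypothesis memE : forall n s,
  (s \in E n) = is_overpartition n s && parts_le m s.

Let E_cons n b s : ((m.+1, b) :: s \in E n) = false.
Proof. by rewrite memE /parts_le /= ltnn !andbF. Qed.

Let parts_leS s : parts_le m s -> parts_le m.+1 s.
Proof. by apply: sub_all => x /= ?; lia. Qed.

Let parts_le_notin s : parts_le m s -> (m.+1, true) \notin s.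
Proof.
move=> le_m; apply/negP => /(map_f fst) /(allP le_m) /=; lia.
Qed.

Lemma add_plain_uniq k n : uniq (add_plain m.+1 E k n).
Proof.
elim: k n => [|k IHk] n /=; first by rewrite cats0.
case: ifP => _; last by rewrite cats0.
rewrite cat_uniq E_uniq map_inj_uniq ?IHk ?andbT => [|s t [] //].
by apply/hasPn => _ /mapP[s _ ->]; rewrite /= E_cons.
Qed.

Lemma mem_add_plain k n s : (n <= k)%N ->
  (s \in add_plain m.+1 E k n) =
  [&& is_overpartition n s, parts_le m.+1 s & (m.+1, true) \notin s].
Proof.
elim: k n s => [|k IHk] n s le_nk /=; rewrite mem_cat memE.
  case: s => [|[a b] s]; first by rewrite orbF andbT.
  move: le_nk; rewrite leqn0 => /eqP ->; rewrite is_overpartition_cons.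
  by case: a.
case: s => [|[a b] s].
  by case: ifP => _; rewrite ?mem_map_nil orbF andbT.
rewrite is_overpartition_cons /parts_le /= inE negb_or.
have [->|a_m] := eqVneq a m.+1; last first.
  have a_m' : ((m.+1, true) == (a, b)) = false.
    by rewrite xpair_eqE eq_sym (negPf a_m).
  rewrite (_ : (_ \in if _ then _ else _) = false) ?orbF; last first.
    by case: ifP => _; rewrite // mem_map_cons xpair_eqE (negPf a_m).
  rewrite a_m' /=; case: (leqP a m) => a_le; last first.
    by rewrite (_ : (a <= m.+1)%N = false) ?andbF //; lia.
  rewrite (leqW a_le) /=; case: (boolP (all (geq a) _)) => [le_a|]; last by rewrite !andbF.
  have le_m : parts_le m s by apply: sub_all le_a => x /= ?; lia.
  move: (parts_leS le_m) (parts_le_notin le_m) (le_m).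
  by rewrite /parts_le => -> -> ->; rewrite !andbT.
rewrite ltnn !andbF /= leqnn; case: (leqP m.+1 n) => lt_mn //=.
rewrite mem_map_cons xpair_eqE eqxx IHk; last by lia.
rewrite xpair_eqE eqxx /= /parts_le.
case: b => /=; rewrite ?andbF //.
by case: (is_overpartition _ _) (all _ _) (_ \notin _) => [] [] [].
Qed.

Lemma add_parts_uniq n : uniq (add_parts m.+1 E n).
Proof.
rewrite /add_parts; case: ifP => _; last by rewrite cats0.
rewrite !cat_uniq E_uniq !map_inj_uniq ?add_plain_uniq => [|s t [] //|s t [] //].
rewrite /= andbT; apply/andP; split; apply/hasPn => t.
  by rewrite mem_cat => /orP[] /mapP[s _ ->]; rewrite /= E_cons.
by case/mapP=> s _ ->; rewrite /= mem_map_cons xpair_eqE andbF.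
Qed.

Lemma mem_add_parts n s :
  (s \in add_parts m.+1 E n) = is_overpartition n s && parts_le m.+1 s.
Proof.
rewrite mem_cat memE; case: s => [|[a b] s].
  case: ifP => _; rewrite ?mem_cat ?mem_map_nil ?orbF //.
rewrite is_overpartition_cons /parts_le /=.
have [->|a_m] := eqVneq a m.+1; last first.
  rewrite (_ : (_ \in if _ then _ else _) = false) ?orbF; last first.
    by case: ifP => _; rewrite // mem_cat !mem_map_cons !xpair_eqE (negPf a_m).
  case: (leqP a m) => a_le; last first.
    by rewrite (_ : (a <= m.+1)%N = false) ?andbF //; lia.
  rewrite (leqW a_le) /=; case: (boolP (all (geq a) _)) => [le_a|]; last by rewrite !andbF.
  have le_m : parts_le m s by apply: sub_all le_a => x /= ?; lia.
  by move: (parts_leS le_m) (le_m); rewrite /parts_le => -> ->.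
rewrite ltnn !andbF /= leqnn; case: (leqP m.+1 n) => lt_mn //=.
rewrite mem_cat !mem_map_cons !xpair_eqE eqxx mem_add_plain; last by lia.
rewrite /parts_le; case: b => /=; rewrite ?orbF;
  by case: (is_overpartition _ _) (all _ _) (_ \notin _) => [] [] [].
Qed.

End Membership.

Lemma overpartitions_leP m :
  (forall n, uniq (overpartitions_le m n)) /\
  (forall n s, (s \in overpartitions_le m n) = is_overpartition n s && parts_le m s).
Proof.
elim: m => [|m [IHu IHm]].
  split=> [[]|n s] //=; case: s => [|[a b] s].
    by rewrite andbT /is_overpartition /= eq_sym; case: n.
  rewrite is_overpartition_cons /parts_le /=.
  by case: ifP => _; rewrite ?inE /=; case: a => [|a]; rewrite /= ?andbF.
by split=> [n | n s]; [exact: add_parts_uniq | exact: mem_add_parts].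
Qed.

Lemma overpartition_parts_le n s : is_overpartition n s -> parts_le n s.
Proof.
case/and4P=> _ _ /eqP <- _; elim: s => //= x s IHs.
by rewrite /parts_le /= leq_addr /=; apply: sub_all IHs => y /= ?; lia.
Qed.

Lemma overpartition_number_le m n :
  (n <= m)%N -> overpartition_number n = size (overpartitions_le m n).
Proof.
move=> le_nm; have [E_uniq memE] := overpartitions_leP m.
rewrite /overpartition_number cardE.
rewrite -(size_map (fun s : n.-bseq ('I_n.+1 * bool) => forget_bound s)).
apply: perm_size; apply: uniq_perm => // [|s].
  rewrite map_inj_uniq ?enum_uniq // => s t /forget_bound_inj; exact: val_inj.
rewrite memE; apply/mapP/andP => [[t] | [s_over _]].
  rewrite mem_enum inE => t_over ->; split=> //.
  have := overpartition_parts_le t_over.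
  by apply: sub_all => x /= ?; lia.
have [t ts] := overpartition_bounded s_over.
by exists t; rewrite // mem_enum inE ts.
Qed.
Lemma size_add_plain_fuel m E k k' n : (n <= k)%N -> (n <= k')%N ->
  size (add_plain m.+1 E k n) = size (add_plain m.+1 E k' n).
Proof.
elim: k k' n => [|k IHk] [|k'] n //=; rewrite !size_cat.
- by rewrite leqn0 => /eqP ->.
- by rewrite leqn0 => _ /eqP ->.
move=> le_k le_k'; congr (_ + _)%N; case: ifP => // lt_mn.
by rewrite !size_map; apply: IHk; lia.
Qed.

(** * The product formula and its logarithmic derivative *)

Definition overpartition_le_gf m := Fps (fun n => (size (overpartitions_le m n))%:Z).

Lemma overpartition_le_gf0 : overpartition_le_gf 0 = 1.
Proof. by apply/fpsP => n; rewrite cf1 /=; case: n. Qed.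

(** Let [x = q^(m+1)] and let [N] count the lists in which [m+1] is never overlined. Then
    [N = G + x N], and allowing the overline gives [G + 2 x N], where [G] is the series for [m]; [N]
    is eliminated. *)
Lemma overpartition_le_gfS m :
  overpartition_le_gf m.+1 * (1 - fps_X m.+1) =
  overpartition_le_gf m * (1 + fps_X m.+1).
Proof.
pose E := overpartitions_le m.
pose N := Fps (fun n => (size (add_plain m.+1 E n n))%:Z).
have N_eq : N = overpartition_le_gf m + fps_X m.+1 * N.
  apply/fpsP => n; rewrite cfD cfXM; case: n => [|n].
    by rewrite /= cats0 addr0.
  rewrite {1}/N /= size_cat PoszD; congr (_ + _); rewrite ltnS.
  case: leqP => // le_mn; rewrite size_map; congr Posz.
  by apply: size_add_plain_fuel; lia.
have gf_eq : overpartition_le_gf m.+1 = overpartition_le_gf m + 2 * (fps_X m.+1 * N).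
  apply/fpsP => n; rewrite cfD cfnM cfXM /= size_cat PoszD; congr (_ + _).
  case: ltnP => [lt_mn | _]; last by rewrite mulr0.
  rewrite size_cat !size_map addnn -mul2n PoszM; congr (_ * Posz _).
  by apply: size_add_plain_fuel; lia.
have E_eq : overpartition_le_gf m = N * (1 - fps_X m.+1).
  by rewrite mulrBr mulr1 {1}N_eq mulrC addrK.
by rewrite gf_eq E_eq; ring.
Qed.

Lemma fps_XD m k : fps_X (m + k)%N = fps_X m * fps_X k.
Proof.
apply/fpsP => n; rewrite cfXM /=; case: leqP => le_mn.
  by rewrite (_ : (n - m == k)%N = (n == m + k)%N) //; lia.
by rewrite (_ : (n == m + k)%N = false) //; lia.
Qed.

Lemma fps_1subX_inj m f : (0 < m)%N -> f * (1 - fps_X m) = 0 -> f = 0.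
Proof.
move=> m_gt0; rewrite mulrC mulrBl mul1r => /eqP; rewrite subr_eq0 => /eqP f_eq.
apply/fpsP; elim/ltn_ind => n IHn; rewrite f_eq cfXM cf0.
by case: leqP => // le_mn; rewrite IHn ?cf0 //; lia.
Qed.

(** The logarithmic derivative of [(1 + q^d) / (1 - q^d)] is [2 d q^d / (1 - q^(2 d))], the sum of
    [2 d q^(d e)] over odd [e]. *)
Definition gauss_weight (d e : int) : int := if oddz e then 2 * d else 0.

Definition gauss_summand (m : nat) :=
  Fps (fun n => if (0 < n)%N && (m %| n)%N then gauss_weight m (n %/ m)%N else 0).

Lemma gauss_summandP m : (0 < m)%N ->
  gauss_summand m * (1 - fps_X m ^+ 2) = 2 * m%:R * fps_X m.
Proof.
move=> m_gt0; rewrite expr2 -fps_XD.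
apply/fpsP => n; rewrite mulrC mulrBl mul1r cfB cfXM -natrM cfnM natz /=.
have [/dvdnP[k ->]|ndvd] := boolP (m %| n)%N; last first.
  rewrite andbF (_ : (n == m) = false) ?mulr0; last first.
    by apply: contraNF ndvd => /eqP ->.
  case: (leqP (m + m) n) => [le_mn|_]; last by rewrite subr0.
  rewrite [X in _ - X]ifF ?subr0 //; apply: contraNF ndvd => /andP[_ m_n].
  by rewrite -(subnK le_mn) dvdn_add // dvdn_add.
case: k => [|[|k]].
- by rewrite mul0n (leqNgt (m + m)) addn_gt0 m_gt0 (ltn_eqF m_gt0) /= mulr0 subr0.
- rewrite (mul1n m) m_gt0 divnn m_gt0 (_ : (m + m <= m)%N = false) /=; last by lia.
  by rewrite /gauss_weight /= eqxx subr0 mulr1 PoszM.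
rewrite (_ : (m + m <= k.+2 * m)%N = true); last by rewrite addnn -mul2n leq_mul2r orbT.
rewrite (_ : (k.+2 * m - (m + m) = k * m)%N); last by rewrite !mulSn; lia.
rewrite dvdn_mull // !mulnK // muln_gt0 m_gt0 /=.
rewrite (_ : (k.+2 * m == m)%N = false); last by rewrite !mulSn; lia.
rewrite mulr0 muln_gt0 m_gt0 andbT /gauss_weight /oddz /=.
by case: k => //= k; rewrite negbK subrr.
Qed.

Fixpoint gauss_series_le m : fps :=
  if m is m'.+1 then gauss_series_le m' + gauss_summand m else 0.

Lemma D_overpartition_le m :
  fps_D (overpartition_le_gf m) = overpartition_le_gf m * gauss_series_le m.
Proof.
elim: m => [|m IHm]; first by rewrite overpartition_le_gf0 fps_D1 mulr0.
have gfS := overpartition_le_gfS m.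
have := congr1 fps_D gfS.
have D_X : fps_D (1 - fps_X m.+1) = - (m.+1%:R * fps_X m.+1).
  by rewrite fps_DD fps_DN fps_D1 fps_DX sub0r.
have D_X' : fps_D (1 + fps_X m.+1) = m.+1%:R * fps_X m.+1.
  by rewrite fps_DD fps_D1 fps_DX add0r.
rewrite !fps_DM D_X D_X' IHm /= => D_eq.
have S_eq := gauss_summandP (ltn0Sn m).
apply/eqP; rewrite -subr_eq0; apply/eqP.
(* Multiplication by [1 - x^2] clears the denominators; what remains is a linear combination of the
   three relations [D_eq], [S_eq] and [gfS]. *)
apply: (@fps_1subX_inj (m.+1 + m.+1)%N) => //.
rewrite fps_XD.
move: D_eq S_eq gfS.
set G' := overpartition_le_gf _; set G := overpartition_le_gf m.
set L := gauss_series_le m; set S := gauss_summand _; set x := fps_X _.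
move=> /(canRL (addrK _))/eqP; rewrite -subr_eq0 => /eqP D_eq.
move=> /eqP; rewrite -subr_eq0 => /eqP S_eq.
move=> /eqP; rewrite -subr_eq0 => /eqP gfS.
transitivity ((1 + x) * 0 - G' * 0 - (L * (1 + x) + m.+1%:R * x) * 0).
  rewrite -{1}D_eq -{1}S_eq -gfS; ring.
by ring.
Qed.
Lemma gauss_series_leE m n :
  (n <= m)%N -> gauss_series_le m n = lambert gauss_weight n.
Proof.
move=> le_nm; transitivity (\sum_(d <- iota 1 m) gauss_summand d n).
  elim: m {le_nm} => [|m IHm]; first by rewrite big_nil cf0.
  by rewrite -addn1 iotaD big_cat big_seq1 -IHm addn1 cfD.
rewrite -(subnKC le_nm) iotaD big_cat /= big_map big_filter.
rewrite [X in _ + X]big1_seq ?addr0 => [|d].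
  rewrite [RHS]big_mkcond; apply: eq_big_seq => d; rewrite mem_iota => /andP[d1 dn].
  by rewrite (_ : (0 < n)%N) //; lia.
rewrite mem_iota /= => /andP[lt_nd _]; rewrite ifF //.
by apply/negP => /andP[n0 /(dvdn_leq n0)]; lia.
Qed.

Definition overpartition_gf := Fps (fun n => (overpartition_number n)%:Z).

Lemma overpartition_gfE m n : (n <= m)%N ->
  overpartition_gf n = overpartition_le_gf m n.
Proof. by move=> le_nm; rewrite /= (overpartition_number_le le_nm). Qed.

Lemma overpartition_gf0 : overpartition_gf 0%N = 1.
Proof. by rewrite (overpartition_gfE (leqnn 0)) overpartition_le_gf0 cf1. Qed.

Lemma D_overpartition :
  fps_D overpartition_gf = overpartition_gf * lambert gauss_weight.
Proof.
apply/fpsP => n; transitivity (fps_D (overpartition_le_gf n) n).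
  by rewrite /fps_D; congr (_ * _); apply: overpartition_gfE.
rewrite D_overpartition_le !cfM; apply: eq_bigr => i _.
have le_in : (i <= n)%N by rewrite -ltnS.
by rewrite (overpartition_gfE le_in) gauss_series_leE ?leq_subr.
Qed.

(* [f(-q)] *)
Definition fps_twist (f : fps) := Fps (fun n => (-1) ^+ n * f n).

Lemma fps_twistM f g : fps_twist (f * g) = fps_twist f * fps_twist g.
Proof.
apply/fpsP => n; rewrite /= mulr_sumr; apply: eq_bigr => i _ /=.
have le_in : (i <= n)%N by rewrite -ltnS.
by rewrite -{1}(subnKC le_in) exprD; ring.
Qed.

Lemma D_twist f : fps_D (fps_twist f) = fps_twist (fps_D f).
Proof. by apply/fpsP => n /=; rewrite mulrCA. Qed.

Lemma twist_lambert g : fps_twist (lambert g) =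
  lambert (fun d e => (-1) ^+ (oddz d && oddz e) * g d e).
Proof.
apply/fpsP => n; rewrite /= mulr_sumr; apply: eq_big_seq => -[d e].
rewrite mem_divisor_pairs => /and3P[_ _ /eqP de_n]; congr (_ * _).
by rewrite -signr_odd -oddzM de_n.
Qed.

Lemma D_lambert g :
  fps_D (lambert g) = lambert (fun d e => d * e * g d e).
Proof.
apply/fpsP => n; rewrite /= mulr_sumr; apply: eq_big_seq => -[d e].
by rewrite mem_divisor_pairs => /and3P[_ _ /eqP <-].
Qed.

Lemma theta_mul_lambert g n :
  (theta * lambert g) n = tsum n (fun u d e => g d e).
Proof.
rewrite (_ : theta = Fps (fun i => 1 * theta i)).
  by rewrite theta_lambert; apply: eq_tsum => u d e; rewrite mul1r.
by apply/fpsP => i; rewrite /= mul1r.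
Qed.

Lemma Dtheta_mul_lambert g n :
  (fps_D theta * lambert g) n = tsum n (fun u d e => u ^+ 2 * g d e).
Proof.
rewrite (theta_lambert Posz); apply: eq_tsum => u d e; congr (_ * _); lia.
Qed.

(** * Gauss's and Jacobi's identities *)

Definition theta_inv := fps_twist overpartition_gf.

Lemma theta_inv0 : theta_inv 0%N = 1.
Proof.
by rewrite -[LHS]/((-1) ^+ 0 * overpartition_gf 0%N) overpartition_gf0 mulr1.
Qed.

Lemma theta0 : theta 0%N = 1.
Proof. by rewrite /= big_cons big_nil. Qed.

(** Gauss's identity: by [tsum_gauss] the two logarithmic derivatives are opposite, so the product
    equals its constant term. *)
Lemma theta_invP : theta * theta_inv = 1.
Proof.
have -> : (1 : fps) = fps_const ((theta * theta_inv) 0%N).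
  apply/fpsP => n; rewrite cf1 cfM big_ord1 theta0 mul1r theta_inv0.
  by case: n.
apply: fps_D_eq0; rewrite fps_DM /theta_inv D_twist D_overpartition fps_twistM.
suff -> : fps_D theta = - (theta * fps_twist (lambert gauss_weight)) by ring.
apply/fpsP => n; rewrite cfN twist_lambert theta_mul_lambert.
apply: oppr_inj; rewrite opprK.
transitivity (- n%:Z * theta n); first by rewrite mulNr.
rewrite -tsum_gauss; apply: eq_tsum => u d e; rewrite /gauss_weight; case: (oddz e).
  by rewrite andbT; ring.
by rewrite mulr0.
Qed.

Lemma fps_DXn f k : fps_D (f ^+ k.+1) = k.+1%:R * f ^+ k * fps_D f.
Proof.
elim: k => [|k IHk]; first by rewrite expr1 expr0 mul1r mul1r.
by rewrite exprS fps_DM IHk -[k.+2]addn1 natrD exprS; ring.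
Qed.

(* Logarithmic differentiation turns [theta ^+ k = 1 + lambert g] into one
   numerical identity for each exponent. *)
Lemma theta_powE k g :
    (forall n, tsum n (fun u d e => (d * e - k.+1%:R * u ^+ 2) * g d e)
      = k.+1%:R * (n%:Z * theta n)) ->
  theta ^+ k.+1 = 1 + lambert g.
Proof.
move=> g_eq; set G := 1 + lambert g; set w := theta_inv.
have tw : theta * w = 1 := theta_invP.
(* This is the differential equation satisfied by [theta ^+ k.+1]; it forces [G * w ^+ k.+1] to be
   constant. *)
have ode : theta * fps_D G = k.+1%:R * (fps_D theta * G).
  apply/fpsP => n; rewrite fps_DD fps_D1 add0r D_lambert theta_mul_lambert.
  rewrite cfnM mulrDr mulr1 cfD Dtheta_mul_lambert mulrDr -g_eq -tsumZ -tsumD.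
  by apply: eq_tsum => u d e; ring.
have Dw : fps_D w = - (w ^+ 2 * fps_D theta).
  have := congr1 fps_D tw; rewrite fps_DM fps_D1 => D0.
  rewrite -[LHS]mul1r -tw -[LHS]subr0 -(mulr0 w) -D0; ring.
suff Gw : G * w ^+ k.+1 = 1.
  by rewrite -[LHS]mulr1 -Gw mulrCA -exprMn tw expr1n mulr1.
have -> : (1 : fps) = fps_const ((G * w ^+ k.+1) 0%N).
  have w0 j : (w ^+ j) 0%N = 1.
    elim: j => [|j IHj]; first by rewrite expr0 cf1.
    by rewrite exprS cfM big_ord1 IHj mulr1 theta_inv0.
  apply/fpsP => n; rewrite cf1 cfM big_ord1 w0 mulr1 cfD lambert0 cf1.
  by case: n.
apply: fps_D_eq0; rewrite fps_DM fps_DXn Dw.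
have -> : fps_D G = w * (k.+1%:R * (fps_D theta * G)).
  by rewrite -ode mulrA (mulrC w) tw mul1r.
by rewrite exprS; ring.
Qed.

Lemma theta4 : theta ^+ 4 = 1 + lambert (fun d e => 8 * c4 d e * d).
Proof. by apply: theta_powE => n; apply: tsum_four. Qed.

Lemma theta6 : theta ^+ 6 =
  1 + lambert (fun d e => quad_char d * (16 * e ^+ 2 - 4 * d ^+ 2)).
Proof. by apply: theta_powE => n; apply: tsum_six. Qed.
(** * Sums of six squares through sums of four squares *)

Lemma eq_lambert n g g' :
    (forall d e, d * e = n%:Z -> g d e = g' d e) -> lambert g n = lambert g' n.
Proof.
move=> gg'; apply: eq_big_seq => -[d e]; rewrite mem_divisor_pairs.
by case/and3P=> _ _ /eqP; apply: gg'.
Qed.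

Lemma lambertD g g' : lambert (fun d e => g d e + g' d e) = lambert g + lambert g'.
Proof. by apply/fpsP => n; rewrite cfD /= big_split. Qed.

Lemma lambertZ (c : int) g n : lambert (fun d e => c * g d e) n = c * lambert g n.
Proof. by rewrite /= mulr_sumr. Qed.

Lemma lambert_swap g : lambert g = lambert (fun d e => g e d).
Proof.
apply/fpsP => n.
have swapP x : x \in divisor_pairs n ->
    (x.2, x.1) \in divisor_pairs n /\ (x.1, x.2) = x.
  by case: x => d e; rewrite !mem_divisor_pairs mulrC => /and3P[-> -> ->].
exact: (sum_bij _ (divisor_pairs_uniq n) (divisor_pairs_uniq n) swapP swapP).
Qed.

(** Pairs with [d e = p n] are split by whether [p] divides [d]: the factor [p] is removed from [d]
    if it does, and from [e] otherwise. *)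
Lemma lambert_prime (p : nat) g n : prime p ->
  lambert g (p * n)%N =
  lambert (fun d e => g (p%:Z * d) e + (if (p %| d)%Z then 0 else g d (p%:Z * e))) n.
Proof.
move=> p_pr; have p_gt0 : 0 < p%:Z by rewrite ltz_nat prime_gt0.
have p_neq0 : p%:Z != 0 by rewrite gt_eqF.
rewrite lambertD cfD /= (bigID (fun x => (p %| x.1)%Z)) /=; congr (_ + _).
  rewrite -[LHS]big_filter.
  apply: (@sum_bij _ _ _ _ _ (fun x => (p%:Z * x.1, x.2))
    (fun x => ((x.1 %/ p)%Z, x.2)) (fun x => g x.1 x.2));
    rewrite ?filter_uniq ?divisor_pairs_uniq // => -[d e].
    rewrite mem_filter !mem_divisor_pairs /= => /and3P[d0 e0 /eqP de].
    by rewrite dvdz_mulr // mulKz // pmulr_rgt0 // d0 e0 -mulrA de PoszM /=.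
  rewrite mem_filter !mem_divisor_pairs /= => /and4P[/dvdzP[k ->] d0 e0 de].
  rewrite mulzK // (mulrC p%:Z); split=> //; rewrite pmulr_lgt0 // in d0.
  rewrite d0 e0; apply/eqP/(mulfI p_neq0); rewrite -PoszM -(eqP de); ring.
rewrite -[LHS]big_filter [RHS](eq_bigr
  (fun x => if ~~ (p %| x.1)%Z then g x.1 (p%:Z * x.2) else 0)); last first.
  by move=> x _; case: ifP.
rewrite -[RHS]big_mkcond -[RHS]big_filter.
apply: (@sum_bij _ _ _ _ _ (fun x => (x.1, p%:Z * x.2))
  (fun x => (x.1, (x.2 %/ p)%Z)) (fun x => g x.1 x.2));
  rewrite ?filter_uniq ?divisor_pairs_uniq // => -[d e].
  rewrite !mem_filter !mem_divisor_pairs /= => /and4P[-> d0 e0 /eqP de].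
  by rewrite mulKz // pmulr_rgt0 // d0 e0 mulrCA de PoszM /=.
rewrite !mem_filter !mem_divisor_pairs /= => /and4P[pd d0 e0 /eqP de].
have /dvdzP[k e_k] : (p %| e)%Z.
  have : (p %| d * e)%Z by rewrite de PoszM dvdz_mulr.
  by rewrite !dvdzE abszM Euclid_dvdM // -!dvdzE (negPf pd).
rewrite e_k mulzK // [p%:Z * k]mulrC pd d0; split=> //.
rewrite e_k pmulr_lgt0 // in e0; rewrite e0 /=.
apply/eqP/(mulfI p_neq0); rewrite -PoszM -de e_k; ring.
Qed.

Lemma quad_char_mul1 n d e : d * e = n%:Z -> (n %% 4 = 1)%N ->
  quad_char e = quad_char d.
Proof.
move=> de n1; have : ((d %% 4)%Z * (e %% 4)%Z = 1 %[mod 4])%Z.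
  rewrite modzMm de; lia.
rewrite /quad_char; have : (0 <= (d %% 4)%Z < 4) by lia.
have : (0 <= (e %% 4)%Z < 4) by lia.
move: (d %% 4)%Z (e %% 4)%Z => [[|[|[|[|x]]]]|x] [[|[|[|[|y]]]]|y] //.
Qed.

Lemma quad_char_mul3 n d e : d * e = n%:Z -> (n %% 4 = 3)%N ->
  quad_char e = - quad_char d.
Proof.
move=> de n1; have : ((d %% 4)%Z * (e %% 4)%Z = 3 %[mod 4])%Z.
  rewrite modzMm de; lia.
rewrite /quad_char; have : (0 <= (d %% 4)%Z < 4) by lia.
have : (0 <= (e %% 4)%Z < 4) by lia.
move: (d %% 4)%Z (e %% 4)%Z => [[|[|[|[|x]]]]|x] [[|[|[|[|y]]]]|y] //.
Qed.

Lemma quad_char2M x : quad_char (2 * x) = 0.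
Proof.
by rewrite /quad_char !ifF //; lia.
Qed.

(** The sum of divisors at odd [n], and 0 at even [n]. *)
Definition odd_sigma := lambert (fun d e => if oddz d && oddz e then d else 0).
(** One of the two Eisenstein series of weight 3 that make up [theta ^+ 6]. *)
Definition twisted_sigma2 := lambert (fun d e => quad_char e * d ^+ 2).

Lemma odd_sigma_even n : ~~ odd n -> odd_sigma n = 0.
Proof.
move=> n_even; rewrite /odd_sigma (@eq_lambert n _ (fun _ _ => 0)) /= ?big1 // => d e de.
by rewrite -oddzM de /oddz /= (negPf n_even).
Qed.

Lemma theta4_odd n : odd n -> (theta ^+ 4) n = 8 * odd_sigma n.
Proof.
move=> n_odd; rewrite theta4 cfD cf1 -lambertZ; case: n n_odd => // n n_odd.
rewrite add0r; apply: eq_lambert => d e de; have : oddz (d * e) by rewrite de.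
by rewrite oddzM => ed; rewrite ed /c4; case/andP: ed => -> _; rewrite mulr1.
Qed.

(** Up to the factor 8, the coefficient at [n > 0] is the sum [O n] of the odd divisors if [n] is
    odd and [3 * O n] if [n] is even. As [O (2 * n) = O n], only odd [n] leave a difference. *)
Lemma theta4_double n : (theta ^+ 4) (2 * n)%N = (theta ^+ 4) n + 16 * odd_sigma n.
Proof.
pose O := lambert (fun d e => if oddz d then d else 0).
(* [Z] appears when a factor 2 is removed from [R]; its recursion [Z (2 m) = 2 Z m - O m] shows that
   it equals [O]. *)
pose Z := lambert (fun d e => if oddz e then d else - d).
pose R := lambert (fun d e => c4 d e * d).
have d2 d : (2%N %| d)%Z = ~~ oddz d by rewrite dvdzE dvdn2.
have O_double m : O (2 * m)%N = O m.
  rewrite lambert_prime //; apply: eq_lambert => d e _.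
  by rewrite oddz2M add0r d2; case: (oddz d).
have Z_double m : Z (2 * m)%N = 2 * Z m - O m.
  rewrite lambert_prime //.
  transitivity (lambert (fun d e => 2 * (if oddz e then d else - d)
                           + (-1) * (if oddz d then d else 0)) m).
    apply: eq_lambert => d e _; rewrite d2 oddz2M.
    by case: (oddz d) (oddz e) => [] []; rewrite /=; ring.
  by rewrite lambertD cfD !lambertZ -/Z -/O mulN1r.
have Z_odd m : odd m -> Z m = O m.
  move=> m_odd; apply: eq_lambert => d e de.
  have : oddz (d * e) by rewrite de.
  by rewrite oddzM => /andP[-> ->].
have ZO m : Z m = O m.
  elim/ltn_ind: m => m IHm; case: (boolP (odd m)) => [|m_even]; first exact: Z_odd.
  case: (posnP m) => [->|m_gt0]; first by rewrite !lambert0.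
  have -> : m = (2 * m./2)%N by lia.
  rewrite Z_double O_double IHm; [ring | lia].
have R_double m : R (2 * m)%N = 3 * O m.
  rewrite lambert_prime //.
  transitivity (lambert (fun d e => 2 * (if oddz e then d else - d)
                           + (if oddz d then d else 0)) m).
    apply: eq_lambert => d e _; rewrite /c4 d2 oddz2M.
    by case: (oddz d) (oddz e) => [] []; rewrite /=; ring.
  by rewrite lambertD !cfD lambertZ -/Z ZO -/O; ring.
have R_odd m : odd m -> R m = O m.
  move=> m_odd; apply: eq_lambert => d e de.
  have : oddz (d * e) by rewrite de.
  by rewrite oddzM /c4 => /andP[-> _]; rewrite mul1r.
have S_odd m : odd m -> odd_sigma m = O m.
  move=> m_odd; apply: eq_lambert => d e de.
  have : oddz (d * e) by rewrite de.
  by rewrite oddzM => /andP[-> ->].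
have t4 m : (theta ^+ 4) m = (m == 0%N)%:R + 8 * R m.
  rewrite theta4 cfD cf1 -lambertZ; congr (_ + _).
  by apply: eq_lambert => d e _; ring.
rewrite !t4 R_double; case: (boolP (odd n)) => [n_odd|n_even].
  by rewrite R_odd // S_odd //; case: n n_odd => // n _; rewrite /=; ring.
rewrite odd_sigma_even //; have n2 : n = (2 * n./2)%N by lia.
have -> : R n = 3 * O n by rewrite n2 R_double O_double.
rewrite muln_eq0 /=; ring.
Qed.

(** * Sums of two squares *)

Definition square_pairs (n : nat) : seq (int * int) :=
  [seq (u, v) | u <- [seq u <- zrange n | (`|u| ^ 2 <= n)%N],
                v <- [seq v <- zrange (n - `|u| ^ 2) |
                        (`|v| ^ 2 == n - `|u| ^ 2)%N]].

Lemma mem_square_pairs n (u v : int) :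
  ((u, v) \in square_pairs n) = (u ^+ 2 + v ^+ 2 == n%:Z).
Proof.
have u2 x : (`|x| ^ 2)%N%:Z = x ^+ 2 by lia.
apply/allpairsPdep/idP => [[a [b]] | /eqP uv_n].
  rewrite !mem_filter => -[/andP[le_an _] /andP[/eqP b2 _] [-> ->]].
  by rewrite -!u2 b2 -PoszD subnKC.
have uv : (`|u| ^ 2 + `|v| ^ 2 = n)%N.
  by apply/eqP; rewrite -eqz_nat PoszD !u2 uv_n.
exists u, v; rewrite !mem_filter !mem_zrange -uv leq_addr addKn eqxx /=.
by rewrite leq_sqr (leq_trans (leq_sqr _) (leq_addr _ _)).
Qed.

Lemma square_pairs_uniq n : uniq (square_pairs n).
Proof.
apply: allpairs_uniq_dep => [|u _|[u v] [u' v'] _ _ [-> ->] //].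
  by rewrite filter_uniq ?zrange_uniq.
by rewrite filter_uniq ?zrange_uniq.
Qed.

Lemma theta2E n : (theta ^+ 2) n = \sum_(x <- square_pairs n) 1.
Proof.
rewrite expr2 theta_mulE big_allpairs_dep big_filter; apply: eq_bigr => u _.
by rewrite big_filter.
Qed.

(** The map [(u, v) -> (u + v, u - v)] is a bijection between the representations; its inverse is
    integral because [u + v] is even when [u^2 + v^2] is. *)
Lemma theta2_double n : (theta ^+ 2) (2 * n)%N = (theta ^+ 2) n.
Proof.
rewrite !theta2E.
apply: (@sum_bij _ _ _ _ _ (fun x => (x.1 + x.2, x.1 - x.2))
  (fun x => (((x.1 + x.2) %/ 2)%Z, ((x.1 - x.2) %/ 2)%Z)) (fun=> 1));
  rewrite ?square_pairs_uniq // => -[u v]; rewrite !mem_square_pairs /=.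
  move/eqP=> uv; split; last by congr (_, _); lia.
  by rewrite PoszM -uv; apply/eqP; ring.
move/eqP=> uv; have uv_even : oddz (u + v) = false.
  by rewrite oddzD -[oddz u]andbb -[oddz v]andbb -!oddzM -oddzD uv PoszM oddz2M.
have [k uk] : exists k, u = 2 * k - v.
  by exists ((u + v) %/ 2)%Z; move: uv_even; rewrite /oddz; lia.
have -> : ((u + v) %/ 2)%Z = k by lia.
have -> : ((u - v) %/ 2)%Z = k - v by lia.
split; last by rewrite uk; congr (_, _); ring.
apply/eqP/(@mulfI _ 2) => //; rewrite -[2 * n%:Z]/(2%:Z * n) -PoszM -uv uk; ring.
Qed.

Lemma theta2_eq0 n : (n %% 4 = 3)%N -> (theta ^+ 2) n = 0.
Proof.
move=> n3; rewrite theta2E big1_seq // => -[u v] /=; rewrite mem_square_pairs.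
have sq4 (x : int) : (x ^+ 2 %% 4)%Z = 0 \/ (x ^+ 2 %% 4)%Z = 1.
  have [k [r [-> r01]]] : exists k r, x = 2 * k + r /\ (r = 0 \/ r = 1).
    by exists (x %/ 2)%Z, (x %% 2)%Z; lia.
  rewrite (_ : _ ^+ 2 = (k ^+ 2 + k * r) * 4 + r ^+ 2); last by ring.
  by rewrite modzMDl; case: r01 => ->; [left | right].
move/eqP=> uv; have := sq4 u; have := sq4 v; lia.
Qed.

(** * Even and odd parts of power series *)

Definition fps_even (f : fps) := Fps (fun n => if odd n then 0 else f n).
Definition fps_odd (f : fps) := Fps (fun n => if odd n then f n else 0).
(* [f(q^2)] *)
Definition fps_sq (f : fps) := Fps (fun n => if odd n then 0 else f n./2).

Lemma cf_even f n : fps_even f n = if odd n then 0 else f n.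
Proof. by []. Qed.

Lemma cf_odd f n : fps_odd f n = if odd n then f n else 0.
Proof. by []. Qed.

Lemma fps_even_odd f : f = fps_even f + fps_odd f.
Proof. by apply/fpsP => n /=; case: odd; rewrite ?addr0 ?add0r. Qed.

Definition supp_odd b (f : fps) := forall n, odd n != b -> f n = 0.

Lemma supp_oddM b c f g :
  supp_odd b f -> supp_odd c g -> supp_odd (b (+) c) (f * g).
Proof.
move=> fb gc n n_bc; rewrite cfM big1 // => -[i /= le_in] _.
case: (eqVneq (odd i) b) => ib; last by rewrite fb ?mul0r.
rewrite gc ?mulr0 // oddB //; apply: contraNneq n_bc => <-.
by rewrite ib addbCA addbb addbF.
Qed.

Lemma supp_even f : supp_odd false (fps_even f).
Proof. by move=> n /=; case: odd. Qed.
Lemma supp_fps_odd f : supp_odd true (fps_odd f).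
Proof. by move=> n /=; case: odd. Qed.

Lemma cf_sq f n : fps_sq f n = if odd n then 0 else f n./2.
Proof. by []. Qed.

Lemma supp_fps_sq f : supp_odd false (fps_sq f).
Proof. by move=> n /=; case: odd. Qed.

(** Used with [p = 2] for series in [q^2], and with [p = 7] for seventh powers modulo 7. *)
Lemma sum_multiples (V : nmodType) p m (F : nat -> V) : (0 < p)%N ->
    (forall i, ~~ (p %| i)%N -> F i = 0) ->
  \sum_(i < (p * m).+1) F i = \sum_(i < m.+1) F (p * i)%N.
Proof.
case: p => // p _ F0; elim: m => [|m IHm]; first by rewrite muln0 !big_ord1 muln0.
rewrite [RHS]big_ord_recr -IHm /= -!(big_mkord xpredT F).
rewrite (@big_cat_nat _ _ _ (p.+1 * m).+1) //=; last by rewrite ltnS leq_mul2l leqnSn orbT.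
rewrite mulnS addSn (@big_nat_recr _ _ _ (p + p.+1 * m).+1) /=; last by lia.
congr (_ + _); rewrite big_nat big1 ?add0r // => i /andP[lt_mi lt_im]; apply: F0.
apply/negP => /dvdnP[k i_k]; move: lt_mi lt_im; rewrite i_k (mulnC k).
rewrite ltn_pmul2l // => lt_mk.
have : (p.+1 * m.+1 <= p.+1 * k)%N by rewrite leq_mul2l lt_mk orbT.
rewrite mulnS; lia.
Qed.

Lemma fps_sqM f g : fps_sq (f * g) = fps_sq f * fps_sq g.
Proof.
apply/fpsP => n; case: (boolP (odd n)) => n_odd.
  by rewrite (supp_oddM (@supp_fps_sq f) (@supp_fps_sq g)) /= ?n_odd.
have -> : n = n./2.*2 by lia.
move: {n n_odd}n./2 => n; rewrite [LHS]/= odd_double doubleK.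
rewrite -mul2n cfM (@sum_multiples _ 2 n (fun i => fps_sq f i * fps_sq g (2 * n - i)%N)).
- apply: eq_bigr => i _; have le_in : (i <= n)%N by rewrite -ltnS.
  by rewrite /= -mulnBr !mul2n !odd_double !doubleK.
- by [].
by move=> i; rewrite dvdn2 negbK => i_odd; rewrite supp_fps_sq ?i_odd // mul0r.
Qed.

Lemma fps_sqn k f : fps_sq (k%:R * f) = k%:R * fps_sq f.
Proof.
by apply/fpsP => n; rewrite cfnM !cf_sq; case: odd; rewrite ?mulr0 ?cfnM.
Qed.

Lemma fps_nat_inj k (f g : fps) : k.+1%:R * f = k.+1%:R * g -> f = g.
Proof.
move=> /fpsP fg; apply/fpsP => n; have := fg n; rewrite !cfnM.
by apply: mulfI; rewrite pnatr_eq0.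
Qed.

Lemma twisted_sigma2_double n :
  twisted_sigma2 (2 * n)%N = 4 * twisted_sigma2 n.
Proof.
rewrite /twisted_sigma2 lambert_prime // -lambertZ; apply: eq_lambert => d e _.
by rewrite quad_char2M mul0r if_same addr0; ring.
Qed.

(** The character agrees at [d] and [e], so the two divisor sums of [theta6] merge with coefficient
    [16 - 4]. For 3 modulo 4 it takes opposite values, giving [16 + 4]. *)
Lemma theta6_mod1 n : (n %% 4 = 1)%N -> (theta ^+ 6) n = 12 * twisted_sigma2 n.
Proof.
move=> n1; rewrite theta6 cfD cf1; case: n n1 => // n n1; rewrite add0r.
transitivity (lambert (fun d e => 16 * (quad_char d * e ^+ 2)
                                  + (-4) * (quad_char e * d ^+ 2)) n.+1).
  by apply: eq_lambert => d e /quad_char_mul1 -> //; ring.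
by rewrite lambertD cfD !lambertZ lambert_swap -/twisted_sigma2; ring.
Qed.

Lemma theta6_mod3 n : (n %% 4 = 3)%N -> (theta ^+ 6) n = 20 * twisted_sigma2 n.
Proof.
move=> n1; rewrite theta6 cfD cf1; case: n n1 => // n n1; rewrite add0r.
transitivity (lambert (fun d e => 16 * (quad_char d * e ^+ 2)
                                  + 4 * (quad_char e * d ^+ 2)) n.+1).
  by apply: eq_lambert => d e /quad_char_mul3 -> //; ring.
by rewrite lambertD cfD !lambertZ lambert_swap -/twisted_sigma2; ring.
Qed.

(** Write [theta^2 = E + O] by parity. The facts on two and four squares give [E = theta^2(q^2)],
    [4 F = E O] and [O^2 = 16 F(q^2)]. Even indices follow by induction from the doubling formula;
    odd ones by comparison with the coefficients of [theta^6 = (E + O)^3]. *)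
Lemma twisted_sigma2E : twisted_sigma2 = theta ^+ 2 * odd_sigma.
Proof.
pose E := fps_even (theta ^+ 2); pose O := fps_odd (theta ^+ 2); pose F := odd_sigma.
have tEO : theta ^+ 2 = E + O := fps_even_odd _.
have sE : supp_odd false E := @supp_even _.
have sO : supp_odd true O := @supp_fps_odd _.
have sF : supp_odd true F.
  by move=> n; rewrite eqb_id => /odd_sigma_even.
have E_sq : E = fps_sq (theta ^+ 2).
  apply/fpsP => n; rewrite cf_sq /E cf_even; case: (boolP (odd n)) => // n_even.
  by rewrite -[RHS]theta2_double (_ : (2 * n./2)%N = n) //; lia.
have t4 : theta ^+ 4 = E ^+ 2 + 2 * (E * O) + O ^+ 2.
  by rewrite (exprM theta 2 2) tEO; ring.
have sEE : supp_odd false (E ^+ 2) by exact: (supp_oddM sE sE).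
have sOO : supp_odd false (O ^+ 2) by exact: (supp_oddM sO sO).
have sEO : supp_odd true (E * O) by exact: (supp_oddM sE sO).
have FEO : 4 * F = E * O.
  apply: (@fps_nat_inj 1); apply/fpsP => n; rewrite !cfnM.
  case: (boolP (odd n)) => n_odd; last first.
    by rewrite sF ?sEO ?(negPf n_odd).
  have := theta4_odd n_odd.
  rewrite t4 !cfD cfnM sEE ?n_odd // sOO ?n_odd // -/F add0r addr0 => ->; ring.
have O_sq : O ^+ 2 = fps_sq (16 * F).
  apply/fpsP => n; case: (boolP (odd n)) => n_odd.
    by rewrite sOO /= ?n_odd.
  have n2 : n = (2 * n./2)%N by lia.
  have t4n : (theta ^+ 4) n = (E ^+ 2) n + (O ^+ 2) n.
    by rewrite t4 !cfD cfnM sEO ?(negPf n_odd) // mulr0 addr0.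
  have E2n : (E ^+ 2) n = (theta ^+ 4) n./2.
    by rewrite E_sq expr2 -fps_sqM -expr2 -exprM cf_sq (negPf n_odd).
  have := theta4_double n./2.
  by rewrite -n2 t4n E2n cf_sq (negPf n_odd) cfnM => /addrI.
have tF : theta ^+ 2 * F = E * F + O * F by rewrite tEO mulrDl.
apply/fpsP; elim/ltn_ind => n IHn; rewrite -/F.
case: (boolP (odd n)) => n_odd; last first.
  case: (posnP n) => [->|n_gt0].
    by rewrite cfM big_ord1 !lambert0 mulr0.
  have n2 : n = (2 * n./2)%N by lia.
  rewrite {1}n2 twisted_sigma2_double IHn; last by lia.
  (* Indeed [4 O F = E O^2], and both [E] and [O^2] are series in [q^2]. *)
  have OF : O * F = fps_sq (4 * (theta ^+ 2 * F)).
    apply: (@fps_nat_inj 3).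
    rewrite mulrCA FEO mulrCA -expr2 O_sq E_sq -fps_sqM -fps_sqn.
    by congr fps_sq; ring.
  rewrite [in RHS]tF [in RHS]cfD (supp_oddM sE sF) ?(negPf n_odd) // add0r OF.
  by rewrite cf_sq (negPf n_odd) cfnM.
have tFn : 4 * (theta ^+ 2 * F) n = (E ^+ 2 * O) n.
  rewrite tF cfD (supp_oddM sO sF) ?n_odd // addr0 -cfnM.
  by congr (cf _ _); rewrite mulrCA FEO; ring.
(* [O] lives on indices 1 modulo 4 and [O^2] on indices 2 modulo 4, so [O^3] contributes only at 3
   modulo 4. *)
have sO4 k : (k %% 4 <> 1)%N -> O k = 0.
  move=> k1; rewrite /O cf_odd; case: ifP => // k_odd.
  by apply: theta2_eq0; lia.
have sO2 k : (k %% 4 <> 2)%N -> (O ^+ 2) k = 0.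
  move=> k2; rewrite O_sq cf_sq; case: ifP => // k_even.
  by rewrite cfnM sF ?mulr0 //; lia.
have t6 : (theta ^+ 6) n = 3 * (E ^+ 2 * O) n + (O ^+ 2 * O) n.
  have -> : theta ^+ 6 = 3 * (E ^+ 2 * O) + O ^+ 2 * O + (E ^+ 2 * E + 3 * (E * O ^+ 2)).
    by rewrite (exprM theta 2 3) tEO; ring.
  rewrite cfD [X in _ + X]cfD !cfnM cfD cfnM (supp_oddM sEE sE) ?n_odd //.
  by rewrite (supp_oddM sE sOO) ?n_odd // mulr0 !addr0.
have [n1|n3] : (n %% 4 = 1)%N \/ (n %% 4 = 3)%N by lia.
  have O3 : (O ^+ 2 * O) n = 0.
    rewrite cfM big1 // => i _; have le_in : (i <= n)%N by rewrite -ltnS.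
    have [i2|i2] := eqVneq (i %% 4)%N 2%N; last by rewrite sO2 ?mul0r //; apply/eqP.
    by rewrite sO4 ?mulr0 //; lia.
  apply: (@mulfI _ 12) => //; rewrite -theta6_mod1 // t6 O3 -tFn; ring.
(* Only indices [i] equal to 2 modulo 4 matter; there [O^2] has coefficient [16 F(i/2)], and
   [E^2 = theta^4(q^2)] has [8 F(i/2)]. *)
have O3 : (O ^+ 2 * O) n = 2 * (E ^+ 2 * O) n.
  rewrite -cfnM mulrA !cfM; apply: eq_bigr => i _.
  have le_in : (i <= n)%N by rewrite -ltnS.
  have [i2|i2] := eqVneq (i %% 4)%N 2%N; last first.
    by rewrite [O (n - i)%N]sO4 ?mulr0 //; lia.
  have i_even : odd i = false by lia.
  congr (_ * _); rewrite cfnM O_sq E_sq expr2 -fps_sqM -expr2 -exprM.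
  rewrite !cf_sq i_even cfnM theta4_odd -/F; [ring | lia].
apply: (@mulfI _ 20) => //; rewrite -theta6_mod3 // t6 O3 -tFn; ring.
Qed.
(** * Reduction modulo 7 *)

Lemma cfX_trunc N (f : fps) k n : (n < N)%N -> (f ^+ k) n = (trunc N f ^+ k)`_n.
Proof.
elim: k n => [|k IHk] n lt_nN; first by rewrite !expr0 cf1 coef1.
rewrite !exprS cfM coefM; apply: eq_bigr => i _.
by rewrite coef_trunc ?IHk ?(leq_trans (ltn_ord i)) // (leq_ltn_trans (leq_subr _ _)).
Qed.

(** Modulo [p], [f^p = f(q^p)]: the Frobenius map of [{poly 'F_p}] is additive and fixes
    integers. *)
Lemma fps_Frobenius (p : nat) (f : fps) n : prime p ->
  ((f ^+ p) n)%:~R = (if (p %| n)%N then f (n %/ p)%N else 0)%:~R :> 'F_p.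
Proof.
move=> p_pr; rewrite (cfX_trunc _ _ (ltnSn n)) -coef_map rmorphXn /=.
have pchar_p : p \in [pchar {poly 'F_p}].
  by rewrite (rmorph_pchar polyC) // pchar_Fp.
rewrite -(pFrobenius_autE pchar_p) /trunc poly_def !rmorph_sum /= coef_sum.
transitivity (\sum_(i < n.+1) (if (i * p == n)%N then (f i)%:~R else 0 : 'F_p)).
  apply: eq_bigr => i _; rewrite -mul_polyC !rmorphM /= map_polyC map_polyXn /=.
  rewrite (rmorph_int polyC) pFrobenius_aut_int pFrobenius_autE -exprM.
  rewrite -(rmorph_int polyC) coefCM coefXn eq_sym.
  by case: eqP => _; rewrite ?mulr0 // mulr1.
case: ifP => [/dvdnP[k ->]|ndvd]; last first.
  rewrite big1 // => i _; case: eqP => // in_n.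
  by rewrite -in_n dvdn_mull in ndvd.
have p_gt0 := prime_gt0 p_pr; rewrite mulnK //.
have lt_k : (k < (k * p).+1)%N by rewrite ltnS leq_pmulr.
rewrite (bigD1 (Ordinal lt_k)) //= eqxx big1 ?addr0 // => i.
by rewrite -val_eqE /= eqn_pmul2r // => /negPf ->.
Qed.

Definition sigma_weight (d e : int) : int :=
  if oddz d && oddz e then -3 else c4 d e.

(** This is [theta^4 - 32 odd_sigma]. The constant 32 is such that, after multiplication by
    [theta^2], the term [16 quad_char e d^2] of [theta^6] changes sign. *)
Definition sigma_series := 1 + lambert (fun d e => 8 * sigma_weight d e * d).

Lemma theta6_swap : theta ^+ 6 =
  1 + lambert (fun d e => 16 * (quad_char e * d ^+ 2) - 4 * (quad_char d * d ^+ 2)).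
Proof.
rewrite theta6; congr (_ + _); apply/fpsP => n.
transitivity (lambert (fun d e => 16 * (quad_char d * e ^+ 2)
                         + - (4 * (quad_char d * d ^+ 2))) n).
  by apply: eq_lambert => d e _; ring.
by rewrite lambertD cfD lambert_swap -cfD -lambertD.
Qed.

Lemma theta2_sigma : theta ^+ 2 * sigma_series =
  1 + lambert (fun d e => - 16 * (quad_char e * d ^+ 2) - 4 * (quad_char d * d ^+ 2)).
Proof.
have -> : sigma_series = theta ^+ 4 - 32 * odd_sigma.
  rewrite theta4 /sigma_series -addrA; congr (_ + _); apply/fpsP => n.
  transitivity (lambert (fun d e => 8 * c4 d e * d
      + -32 * (if oddz d && oddz e then d else 0)) n).
    apply: eq_lambert => d e _; rewrite /sigma_weight /c4.
    by case: (oddz d) (oddz e) => [] [] /=; ring.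
  by rewrite lambertD cfD lambertZ mulNr cfB cfnM.
have -> : theta ^+ 2 * (theta ^+ 4 - 32 * odd_sigma)
    = theta ^+ 6 - 32 * (theta ^+ 2 * odd_sigma) by ring.
rewrite -twisted_sigma2E theta6_swap -addrA; congr (_ + _); apply/fpsP => n.
rewrite cfB cfnM -[32 * _]opprK -mulNr -lambertZ opprK -cfD -lambertD.
by apply: eq_lambert => d e _; ring.
Qed.

Lemma quad_char7M x : quad_char (7 * x) = - quad_char x.
Proof.
rewrite /quad_char.
have : ((x %% 4)%Z = 0 \/ (x %% 4)%Z = 1) \/ ((x %% 4)%Z = 2 \/ (x %% 4)%Z = 3) by lia.
by move=> [[]|[]] x4; (have -> : ((7 * x) %% 4)%Z = ((3 * (x %% 4)%Z) %% 4)%Z by lia);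
  rewrite x4.
Qed.

(** Modulo 7 only divisors [d] prime to 7 count. The factor 7 then goes to [e], and
    [quad_char 7 = -1] produces the sign change built into [sigma_series]. *)
Lemma theta6_mul7 n :
  ((theta ^+ 6) (7 * n)%N)%:~R = ((theta ^+ 2 * sigma_series) n)%:~R :> 'F_7.
Proof.
rewrite theta2_sigma theta6_swap cfD [in RHS]cfD !cf1 muln_eq0 !intrD; congr (_ + _).
rewrite lambert_prime // (_ : 7%N%:Z = 7) //= !rmorph_sum; apply: eq_bigr => -[d e] _ /=.
have z7 : (7 : int)%:~R = 0 :> 'F_7 by apply/eqP.
have mul7 (x : int) : (7 * x)%:~R = 0 :> 'F_7 by rewrite intrM z7 mul0r.
rewrite intrD [X in X + _](_ : _ = 0); last first.
  rewrite -[RHS](mul7 (16 * (quad_char e * (7 * d ^+ 2))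
    - 4 * (quad_char (7 * d) * (7 * d ^+ 2)))); congr (_%:~R); ring.
rewrite add0r; case: ifP => [/dvdzP[k ->]|_].
  transitivity (0 : 'F_7) => //; rewrite -[LHS](mul7 (- 16 * (quad_char e * (7 * k ^+ 2))
    - 4 * (quad_char (k * 7) * (7 * k ^+ 2)))); congr (_%:~R); ring.
by rewrite quad_char7M; congr (_%:~R); ring.
Qed.

Lemma theta_inv_mul7 n :
  (theta_inv (7 * n)%N)%:~R = ((theta * sigma_series) n)%:~R :> 'F_7.
Proof.
have tw : theta * theta_inv = 1 := theta_invP.
have -> : theta * sigma_series = theta_inv * (theta ^+ 2 * sigma_series).
  by rewrite expr2 -mulrA mulrA (mulrC theta_inv) tw mul1r.
have -> : theta_inv (7 * n)%N = (theta_inv ^+ 7 * theta ^+ 6) (7 * n)%N.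
  have -> // : theta_inv ^+ 7 * theta ^+ 6 = theta_inv.
  by rewrite -[RHS]mul1r -(expr1n fps 6) -tw; ring.
rewrite !cfM !rmorph_sum.
pose H i := ((theta_inv ^+ 7) i * (theta ^+ 6) (7 * n - i)%N)%:~R : 'F_7.
(* Modulo 7, [theta_inv ^+ 7] is supported on multiples of 7, so [theta ^+ 6] is only evaluated at
   such multiples. *)
transitivity (\sum_(i < n.+1) H (7 * i)%N).
  apply: (@sum_multiples _ 7 n H) => // i ndvd.
  by rewrite /H intrM fps_Frobenius // (negPf ndvd) mul0r.
apply: eq_bigr => i _; rewrite /H intrM fps_Frobenius // dvdn_mulr // mulKn //.
by rewrite -mulnBr theta6_mul7 -intrM.
Qed.
(** * Zagier's sum over quadratic forms *)

Section ZagierSum.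

Variables (c : bool -> bool -> int) (N : nat).
Hypothesis c_sym : forall a b, c a b = c b a.
Hypothesis N_nonsquare : forall l : int, l ^+ 2 <> N%:Z.

Definition parity_sum (n : nat) := tsum n (fun u d e => c (oddz d) (oddz e) * d).

(* The triple [(u, d, g)] stands for the binary quadratic form
   [- d x^2 + 2 u x y + g y^2] of determinant [u^2 + d g]. *)
Definition form (p q : int) (t : int * int * int) : int :=
  - t.1.2 * p ^+ 2 + 2 * t.1.1 * p * q + t.2 * q ^+ 2.

Definition weight (t : int * int * int) : int := c (oddz t.1.2) (oddz t.2).

(* Zagier's sum over the forms negative at [(1, 0)] and positive at [(p, q)];
   [s] lists these finitely many forms. *)
Definition zagier_constant (p q : int) := exists s : seq (int * int * int),
  [/\ uniq s,
      forall t, (t \in s) = [&& t.1.1 ^+ 2 + t.1.2 * t.2 == N%:Z, 0 < t.1.2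
                              & 0 < form p q t]
    & \sum_(t <- s) weight t * form p q t = q ^+ 2 * parity_sum N].

(** At [(0, q)] positivity means [g > 0], so the forms concerned are exactly [triples N]. *)
Lemma zagier_constant0l q : 0 < q -> zagier_constant 0 q.
Proof.
move=> q_gt0; exists (triples N); split; first exact: triples_uniq.
  move=> [[u d] g]; rewrite mem_triples /form /= expr0n /= !mulr0 mul0r !add0r.
  rewrite pmulr_lgt0 ?exprn_gt0 //.
  by case: (0 < d); case: (0 < g); rewrite ?andbF ?andbT.
rewrite /parity_sum tsum_swap /tsum mulr_sumr; apply: eq_bigr => t _.
by rewrite /weight /form c_sym; ring.
Qed.

Lemma zagier_constant0r p : zagier_constant p 0.
Proof.
exists [::]; split=> // [t|]; last by rewrite big_nil expr0n mul0r.
rewrite in_nil; apply/esym/negP => /and3P[_ d_gt0]; rewrite /form expr0n /= !mulr0 !addr0.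
by rewrite mulNr oppr_gt0 ltNge mulr_ge0 ?sqr_ge0 // ltW.
Qed.

(** A change of forms that keeps [d] and the parity of [g] keeps the weight, and so carries the sum
    from one point to another. *)
Lemma zagier_constant_change p q p' q' (f g : int * int * int -> int * int * int) :
    cancel f g -> cancel g f ->
    (forall t, (f t).1.1 ^+ 2 + (f t).1.2 * (f t).2 = t.1.1 ^+ 2 + t.1.2 * t.2) ->
    (forall t, (f t).1.2 = t.1.2) ->
    (forall t, oddz (f t).2 = oddz t.2) ->
    (forall t, form p' q' (f t) = form p q t) -> q' ^+ 2 = q ^+ 2 ->
  zagier_constant p q -> zagier_constant p' q'.
Proof.
move=> fK gK f_det f_d f_odd f_form qq [s [s_uniq s_mem s_sum]].
exists [seq f t | t <- s]; split.
- by rewrite map_inj_uniq //; apply: can_inj fK.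
- move=> t; rewrite -[t]gK mem_map; last exact: can_inj fK.
  by rewrite s_mem f_det f_d f_form.
rewrite big_map qq -s_sum; apply: eq_bigr => t _.
by rewrite f_form /weight f_d f_odd.
Qed.

Lemma zagier_constantN p q : zagier_constant p q -> zagier_constant (- p) q.
Proof.
have K : involutive (fun t : int * int * int => (- t.1.1, t.1.2, t.2)).
  by move=> [[u d] g]; rewrite /= opprK.
apply: (zagier_constant_change K K) => // t; rewrite /= ?sqrrN //.
by rewrite /form /=; ring.
Qed.

(** The shift is by [2 q] rather than [q] to preserve the parity of [g]. *)
Lemma zagier_constant_translate p q :
  zagier_constant p q -> zagier_constant (p + 2 * q) q.
Proof.
pose f (t : int * int * int) : int * int * int :=
  (t.1.1 + 2 * t.1.2, t.1.2, t.2 - 2 * (2 * t.1.1 + 2 * t.1.2)).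
pose g (t : int * int * int) : int * int * int :=
  (t.1.1 - 2 * t.1.2, t.1.2, t.2 - 2 * (2 * t.1.2 - 2 * t.1.1)).
apply: (@zagier_constant_change _ _ _ _ f g) => //.
- by move=> [[u d] e]; rewrite /f /g /=; congr (_, _, _); ring.
- by move=> [[u d] e]; rewrite /f /g /=; congr (_, _, _); ring.
- by move=> t; rewrite /f /=; ring.
- by move=> t; rewrite /f /= oddzD oddzN oddz2M addbF.
by move=> t; rewrite /f /form /=; ring.
Qed.

(** The forms are split by the sign of [g], which is non-zero since [N] is not a square. Those with
    [g < 0] at the two points are exchanged by [sigma]. Those with [g > 0] are, at [(p, q)], the
    forms of [triples N] with positive value and, at [(q, p)], a copy of those with negative value;
    the sum over all of [triples N] is explicit. *)
Lemma zagier_constant_swap p q :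
  p != 0 -> q != 0 -> zagier_constant q p -> zagier_constant p q.
Proof.
move=> p0 q0 [s [s_uniq s_mem s_sum]].
pose sigma (t : int * int * int) : int * int * int := (t.1.1, - t.2, - t.1.2).
have sigmaK : involutive sigma by move=> [[u d] g]; rewrite /sigma /= !opprK.
have form_sigma t : form p q (sigma t) = form q p t.
  by rewrite /form /sigma /=; ring.
have weight_sigma t : weight (sigma t) = weight t.
  by rewrite /weight /= !oddzN c_sym.
pose s1 := [seq t <- triples N | 0 < form p q t].
pose s2 := [seq sigma t | t <- s & t.2 < 0].
have mem_s1 t : (t \in s1) = [&& t.1.1 ^+ 2 + t.1.2 * t.2 == N%:Z, 0 < t.1.2,
    0 < form p q t & 0 < t.2].
  case: t => [[u d] g]; rewrite mem_filter mem_triples /=.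
  by case: (0 < form _ _ _); case: (0 < d); case: (0 < g); rewrite /= ?andbT ?andbF.
have mem_s2 t : (t \in s2) = [&& t.1.1 ^+ 2 + t.1.2 * t.2 == N%:Z, 0 < t.1.2,
    0 < form p q t & t.2 < 0].
  rewrite -[t in LHS]sigmaK mem_map; last exact: inv_inj.
  rewrite mem_filter s_mem -{1}form_sigma sigmaK /= !oppr_gt0 oppr_lt0 mulrNN (mulrC t.2).
  by case: (t.2 < 0); case: (0 < t.1.2); rewrite /= ?andbT ?andbF.
exists (s1 ++ s2); split.
- rewrite cat_uniq !filter_uniq ?triples_uniq // map_inj_uniq; last exact: inv_inj.
  rewrite filter_uniq // andbT; apply/hasPn => t; rewrite mem_s2 /= mem_s1.
  by case/and4P=> _ _ _ g_lt0; rewrite (lt_gtF g_lt0) !andbF.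
- move=> t; rewrite mem_cat mem_s1 mem_s2.
  case: eqP => //= det; case: (0 < t.1.2) => //=; case: (0 < form p q t) => //=.
  case: (ltgtP t.2 0) => // g0; case: (N_nonsquare (l := t.1.1)).
  by rewrite -det g0 mulr0 addr0.
have s2_sum : \sum_(t <- s2) weight t * form p q t =
    \sum_(t <- s | t.2 < 0) weight t * form q p t.
  rewrite big_map big_filter; apply: eq_bigr => t _.
  by rewrite weight_sigma form_sigma.
rewrite big_cat /= s2_sum big_filter.
have := s_sum; rewrite (bigID (fun t => t.2 < 0)) /= => s_split.
have pos_part : \sum_(t <- s | ~~ (t.2 < 0)) weight t * form q p t =
    \sum_(t <- triples N | form p q t < 0) - (weight t * form p q t).
  rewrite -[LHS]big_filter -[RHS]big_filter.
  pose f (t : int * int * int) : int * int * int := (- t.1.1, t.2, t.1.2).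
  have form_f t : form p q (f t) = - form q p t.
    by rewrite /form /f /=; ring.
  have form_f' t : form q p (f t) = - form p q t.
    by rewrite /form /f /=; ring.
  rewrite (@sum_bij _ _ _ [seq t <- triples N | form p q t < 0] _ f f);
    rewrite ?filter_uniq ?triples_uniq //.
  - by apply: eq_bigr => t _; rewrite form_f' /weight c_sym /=; ring.
  - move=> [[u d] g]; rewrite !mem_filter s_mem mem_triples form_f' /f /= sqrrN oppr_gt0.
    case/and4P=> -> d_gt0 g_gt0 det.
    by rewrite (mulrC g) det g_gt0 opprK -leNgt ltW.
  move=> [[u d] g]; rewrite !mem_filter form_f s_mem mem_triples /f /= oppr_lt0 sqrrN.
  case/and4P=> g_ge0 det d_gt0 ->; rewrite (mulrC g) det d_gt0 opprK; split=> //.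
  rewrite lt_neqAle leNgt g_ge0 !andbT; apply/eqP => g0; case: (N_nonsquare (l := u)).
  by rewrite -(eqP det) -g0 mulr0 addr0.
have all_part : \sum_(t <- triples N) weight t * form p q t
    = (q ^+ 2 - p ^+ 2) * parity_sum N.
  pose W u d e := c (oddz d) (oddz e) * (- d * p ^+ 2 + 2 * u * p * q + e * q ^+ 2).
  rewrite -[LHS]/(tsum N W).
  transitivity (tsum N (fun u d e => - p ^+ 2 * (c (oddz d) (oddz e) * d)
      + (2 * p * q * (c (oddz d) (oddz e) * u)
      + q ^+ 2 * (c (oddz e) (oddz d) * e)))).
    by apply: eq_tsum => u d e; rewrite /W (c_sym (oddz e)); ring.
  have u_sum : tsum N (fun u d e => c (oddz d) (oddz e) * u) = 0.
    by apply: tsum_odd => u d e; rewrite mulrN.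
  have e_sum : tsum N (fun u d e => c (oddz e) (oddz d) * e) = parity_sum N.
    by rewrite [RHS]tsum_swap.
  by rewrite !tsumD !tsumZ u_sum e_sum -/(parity_sum N); ring.
rewrite pos_part in s_split.
have tri_split : \sum_(t <- triples N) weight t * form p q t =
    \sum_(t <- triples N | 0 < form p q t) weight t * form p q t
    - \sum_(t <- triples N | form p q t < 0) - (weight t * form p q t).
  rewrite sumrN opprK [in RHS]big_mkcond [X in _ + X]big_mkcond -big_split /=.
  apply: eq_bigr => t _; case: (ltgtP (form p q t) 0) => [||->].
  - by rewrite add0r.
  - by rewrite addr0.
  by rewrite mulr0 addr0.
rewrite all_part in tri_split.
rewrite (_ : q ^+ 2 * _ = (q ^+ 2 - p ^+ 2) * parity_sum N
  + p ^+ 2 * parity_sum N); last by ring.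
by rewrite tri_split -s_split; ring.
Qed.

(** A Euclidean algorithm made of shifts by 2, sign changes and inversions. These preserve the
    parity condition, so the descent reaches [0/1] or [1/0] and never [1/1]. *)
Lemma zagier_constant_coprime (p q : nat) :
  coprime p q -> ~~ (odd p && odd q) -> zagier_constant p%:Z q%:Z.
Proof.
have [k] := ubnP (p + q); elim: k p q => // k IHk p q; rewrite ltnS => le_k co odd_pq.
have step a b : (0 < b)%N -> (b < a)%N -> (a + b <= k)%N -> coprime a b ->
    ~~ (odd a && odd b) -> zagier_constant a%:Z b%:Z.
  move=> b_gt0 lt_ba le_ab co_ab odd_ab.
  have -> : a%:Z = (a%:Z - 2 * b%:Z) + 2 * b%:Z by ring.
  apply: zagier_constant_translate.
  set x := a%:Z - 2 * b%:Z.
  have co' : coprime (absz x) b.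
    rewrite -[coprime _ _]/(coprimez x b) coprimez_sym /coprimez /x -mulNr addrC.
    by rewrite gcdzMDl gcdzC.
  have odd' : ~~ (odd (absz x) && odd b).
    by rewrite -[odd (absz x)]/(oddz x) oddzD oddzN oddz2M addbF.
  have small : (absz x + b < k)%N by rewrite /x; lia.
  have := IHk _ _ small co' odd'.
  case: (lerP 0 x) => x0; first by rewrite gez0_abs.
  by rewrite ltz0_abs // => /zagier_constantN; rewrite opprK.
have [p0|p_gt0] := posnP p.
  move: co; rewrite p0 /coprime gcd0n => /eqP ->; exact: zagier_constant0l.
have [q0|q_gt0] := posnP q; first by rewrite q0; apply: zagier_constant0r.
case: (ltngtP p q) => [lt_pq|lt_qp|pq]; last first.
- by move: co odd_pq; rewrite pq /coprime gcdnn => /eqP ->.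
- exact: step.
apply: zagier_constant_swap; rewrite ?eqz_nat -?lt0n //.
by apply: step; rewrite // 1?addnC // 1?coprime_sym // andbC.
Qed.

End ZagierSum.
(** * The Hecke relation *)

Lemma dvdz_primeM (Q : nat) (x y : int) : prime Q ->
  (Q %| x * y)%Z = (Q %| x)%Z || (Q %| y)%Z.
Proof. by move=> Q_pr; rewrite !dvdzE abszM Euclid_dvdM. Qed.

Lemma dvdz_prime_sqr (Q : nat) (x : int) : prime Q -> (Q %| x ^+ 2)%Z = (Q %| x)%Z.
Proof. by move=> Q_pr; rewrite expr2 dvdz_primeM // orbb. Qed.

Lemma dvdz_prime2_Gauss (Q : nat) (x y : int) : prime Q ->
  ~~ (Q %| x)%Z -> (Q%:Z ^+ 2 %| x * y)%Z = (Q%:Z ^+ 2 %| y)%Z.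
Proof.
move=> Q_pr Qx; rewrite Gauss_dvdzr // coprimezXl //.
by rewrite /coprimez /gcdz /= eqz_nat -/(coprime _ _) prime_coprime.
Qed.

Lemma sum_linear_residue (Q : nat) (a b : int) : prime Q -> ~~ (Q %| a)%Z ->
  (\sum_(i < Q) (Q %| (b + i%:Z * a)%R)%Z = 1)%N.
Proof.
move=> Q_pr Qa; have Q_gt0 := prime_gt0 Q_pr.
have co : coprimez a Q.
  by rewrite coprimez_sym /coprimez /gcdz /= eqz_nat -/(coprime _ _) prime_coprime.
have [x [y xy]] : exists x y : int, x * a + y * Q = 1.
  by have [[x y] /= xy] := coprimezP _ _ co; exists x, y.
(* [x] inverts [a] modulo [Q], so the unique root is [- b x]. *)
have r_lt : (`|((- b * x) %% Q)%Z| < Q)%N by lia.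
have r_eq : (`|((- b * x) %% Q)%Z|)%:Z = ((- b * x) %% Q)%Z by lia.
pose r := Ordinal r_lt.
have Qi (i : nat) : (Q %| (b + i%:Z * a)%R)%Z = (Q %| i%:Z - r%:Z)%Z.
  have -> : b + i%:Z * a = a * (i%:Z - r%:Z) + (b * y - a * ((- b * x) %/ Q)%Z) * Q.
    have := divz_eq (- b * x) Q; rewrite -r_eq -[X in _ = _ + X]/(r%:Z) => r_div.
    have -> : r%:Z = - b * x - ((- b * x) %/ Q)%Z * Q by rewrite {1}r_div; ring.
    have -> : b + i%:Z * a = b * (x * a + y * Q) + i%:Z * a by rewrite xy mulr1.
    ring.
  rewrite rpredDr; last exact: dvdz_mull.
  by rewrite dvdz_primeM // (negPf Qa).
rewrite (bigD1 r) //= Qi subrr dvdz0 big1 // => i i_r.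
rewrite Qi -eqz_mod_dvd !modz_nat eqz_nat !modn_small //.
by rewrite -val_eqE in i_r; rewrite (negPf i_r).
Qed.

Section Hecke.

Variables (c : bool -> bool -> int) (Q M : nat).
Hypotheses (c_sym : forall a b, c a b = c b a) (Q_prime : prime Q) (Q_odd : odd Q).
Hypothesis Q_M : ~~ (Q %| M)%N.

Let q : int := Q.
Let N := (Q * M)%N.

Let q_neq0 : q != 0.
Proof. by rewrite eqz_nat -lt0n prime_gt0. Qed.

Lemma nonsquare_prime_exactly l : l ^+ 2 <> N%:Z.
Proof.
move=> lN; have : (Q %| l ^+ 2)%Z by rewrite lN PoszM dvdz_mulr.
rewrite dvdz_prime_sqr // => /dvdzP[k lk]; move/negP: Q_M; apply.
have : q * M%:Z = q * (k ^+ 2 * q) by rewrite -PoszM -lN lk; ring.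
move/(mulfI q_neq0) => MQ; suff : (q %| M%:Z)%Z by [].
by rewrite MQ dvdz_mull.
Qed.

(* The form [t] is [f(x + 2 i y, Q y)] for some integral form [f]. *)
Let liftable (i : nat) (t : int * int * int) :=
  (q %| t.1.1 + i%:Z * (2 * t.1.2))%Z &&
  (q ^+ 2 %| t.2 - 2 * t.1.1 * (2 * i%:Z) - t.1.2 * (2 * i%:Z) ^+ 2)%Z.

(** Each form of determinant [Q^3 M] arises from exactly one of the [Q + 1] substitutions; the cases
    are ordered by the power of [Q] dividing [d]. *)
Lemma count_liftable t : t \in triples (Q ^ 2 * N) ->
  ((q ^+ 2 %| t.1.2)%Z + \sum_(i < Q) liftable i t = 1)%N.
Proof.
case: t => [[u d] g]; rewrite mem_triples => /and3P[_ _ /eqP det].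
rewrite /liftable /=.
pose v i := u + i%:Z * (2 * d).
pose g' i := g - 2 * u * (2 * i%:Z) - d * (2 * i%:Z) ^+ 2.
have det' i : v i ^+ 2 + d * g' i = q ^+ 3 * M.
  transitivity (u ^+ 2 + d * g); first by rewrite /v /g'; ring.
  by rewrite det /N /q !PoszM; ring.
have Q2 : ~~ (Q %| 2)%Z.
  rewrite dvdzE /=; apply: contraL Q_odd => Q2.
  by move: Q2; rewrite dvdn_prime2 // => /eqP ->.
have Q_sum (b a : int) : ~~ (Q %| a)%Z ->
    (\sum_(i < Q) (q %| (b + i%:Z * (2 * a))%R)%Z = 1)%N.
  by move=> Qa; apply: sum_linear_residue; rewrite // dvdz_primeM // negb_or Q2.
rewrite (eq_bigr (fun i : 'I_Q => (q %| v i)%Z && (q ^+ 2 %| g' i)%Z : nat)) //.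
(* If [Q] does not divide [d], [det'] shows that [Q | v i] already implies [Q^2 | g' i], and
   [Q | v i] is a linear congruence in [i]. *)
case: (boolP (q %| d)%Z) => [/dvdzP[d' d_d']|Qd]; last first.
  rewrite (_ : (q ^+ 2 %| d)%Z = false) ?add0n; last first.
    by apply: contraNF Qd; apply: dvdz_trans; rewrite expr2 dvdz_mulr.
  rewrite -[RHS](Q_sum u d Qd); apply: eq_bigr => i _; congr nat_of_bool.
  case: (boolP (q %| u + _)%Z) => //= /dvdzP[k vk].
  rewrite -(dvdz_prime2_Gauss _ Q_prime Qd).
  have -> : d * g' i = (q * M - k ^+ 2) * q ^+ 2.
    by apply: (addrI (v i ^+ 2)); rewrite det' /v vk; ring.
  by rewrite dvdz_mull.
have v2 i : (q %| v i ^+ 2)%Z.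
  have -> : v i ^+ 2 = (q ^+ 2 * M - d' * g' i) * q.
    by apply: (addIr (d * g' i)); rewrite det' d_d'; ring.
  by rewrite dvdz_mull.
have v1 i : (q %| v i)%Z by rewrite -dvdz_prime_sqr.
have [u' u_u'] : exists u', u = u' * q.
  by apply/dvdzP; have := v1 0%N; rewrite /v mul0r addr0.
pose v' i := u' + i%:Z * (2 * d').
have det'' i : q * v' i ^+ 2 + d' * g' i = q ^+ 2 * M.
  apply: (mulfI q_neq0); transitivity (v i ^+ 2 + d * g' i).
    by rewrite /v /v' d_d' u_u'; ring.
  by rewrite det'; ring.
(* If [Q] divides [d] exactly once, every [v i] is divisible by [Q] and [det''] turns [Q^2 | g' i]
   into the linear congruence [Q | v' i]. *)
case: (boolP (q %| d')%Z) => [/dvdzP[d'' d_d'']|Qd']; last first.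
  rewrite (_ : (q ^+ 2 %| d)%Z = false) ?add0n; last first.
    apply: contraNF Qd' => /dvdzP[k]; rewrite d_d' expr2 mulrA => /(mulIf q_neq0) ->.
    exact: dvdz_mull.
  rewrite -[RHS](Q_sum u' d' Qd'); apply: eq_bigr => i _; congr nat_of_bool.
  rewrite v1 /= -(dvdz_prime2_Gauss _ Q_prime Qd').
  have -> : d' * g' i = q ^+ 2 * M - q * v' i ^+ 2.
    by rewrite -(det'' i) addrAC subrr add0r.
  rewrite rpredBl; last exact: dvdz_mulr.
  by rewrite expr2 dvdz_mul2l // dvdz_prime_sqr.
rewrite (_ : (q ^+ 2 %| d)%Z = true); last first.
  by rewrite d_d' d_d'' -mulrA -expr2 dvdz_mull.
(* If [Q^2 | d], a liftable index would force [Q | M]. *)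
rewrite big1 // => i _; apply/eqP; rewrite eqb0 v1 /=; apply/negP => /dvdzP[k gk].
have v'2 : v' i ^+ 2 = (M%:Z - d'' * k * q) * q.
  apply: (mulfI q_neq0); apply: (addIr (d' * g' i)).
  by rewrite det'' gk d_d''; ring.
have /dvdzP[l v'l] : (q %| v' i)%Z by rewrite -dvdz_prime_sqr // v'2 dvdz_mull.
move/negP: Q_M; apply; suff : (q %| M%:Z)%Z by [].
have -> : M%:Z = (l ^+ 2 + d'' * k) * q.
  apply: (addIr (- (d'' * k * q))); apply: (mulIf q_neq0).
  by rewrite -v'2 v'l; ring.
by rewrite dvdz_mull.
Qed.

Let W (t : int * int * int) : int := weight c t * t.2.

(** These are the forms [f(Q x, y)] with [f] of determinant [N]; [g] is unchanged and, [Q] being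
    odd, so is the weight. *)
Lemma lift_infinity :
  \sum_(t <- triples (Q ^ 2 * N) | (q ^+ 2 %| t.1.2)%Z) W t = parity_sum c N.
Proof.
rewrite /parity_sum tsum_swap /tsum -[LHS]big_filter.
pose f (t : int * int * int) : int * int * int := (q * t.1.1, q ^+ 2 * t.1.2, t.2).
pose g (t : int * int * int) : int * int * int :=
  ((t.1.1 %/ q)%Z, (t.1.2 %/ q ^+ 2)%Z, t.2).
have q2_gt0 : 0 < q ^+ 2 by rewrite exprn_gt0 // ltz_nat prime_gt0.
have q2_neq0 : q ^+ 2 != 0 by rewrite gt_eqF.
have QN : (Q ^ 2 * N)%N%:Z = q ^+ 2 * N%:Z by rewrite PoszM -mulnn PoszM expr2.
rewrite (@sum_bij _ _ _ (triples N) _ f g) ?filter_uniq ?triples_uniq //.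
- apply: eq_bigr => t _; rewrite /W /weight /f /= c_sym oddzM expr2 oddzM.
  by rewrite /oddz /q /= Q_odd.
- move=> [[u d] e]; rewrite mem_filter !mem_triples /f /g /= => /and3P[d0 e0 /eqP det].
  rewrite dvdz_mulr // pmulr_rgt0 // d0 e0 QN -det; split.
    by apply/eqP; ring.
  by rewrite !mulKz.
move=> [[u d] e]; rewrite mem_filter !mem_triples /f /g /=.
case/and4P=> /dvdzP[k ->]; rewrite pmulr_lgt0 // => k0 e0 /eqP; rewrite QN => det.
have /dvdzP[l ul] : (q %| u)%Z.
  rewrite -dvdz_prime_sqr //; have -> : u ^+ 2 = (q * (N%:Z - k * e)) * q.
    by apply: (addIr (k * q ^+ 2 * e)); rewrite det; ring.
  exact: dvdz_mull.
rewrite ul !mulzK // k0 e0; split; last by congr (_, _, _); ring.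
by apply/eqP/(mulfI q2_neq0); rewrite -det ul; ring.
Qed.

(** The coefficient [g] of [f(x + 2 i y, Q y)] is the value of [f] at [(2 i, Q)], so this is
    Zagier's sum at that point. *)
Lemma lift_residue (i : 'I_Q) :
  \sum_(t <- triples (Q ^ 2 * N) | liftable i t) W t = q ^+ 2 * parity_sum c N.
Proof.
have q_gt0 : 0 < q by rewrite ltz_nat prime_gt0.
have q2_neq0 : q ^+ 2 != 0 by rewrite expf_neq0.
have QN : (Q ^ 2 * N)%N%:Z = q ^+ 2 * N%:Z by rewrite PoszM -mulnn PoszM expr2.
(* An even shift satisfies the parity condition of [zagier_constant_coprime]; as [Q] is odd, [2 i]
   still runs over all residues. *)
pose j : int := 2 * i%:Z.
have [s [s_uniq s_mem <-]] : zagier_constant c N j q.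
  have [i0|i0] := posnP i.
    by rewrite /j i0; apply: zagier_constant0l.
  have -> : j = (2 * i)%N%:Z by rewrite PoszM.
  apply: zagier_constant_coprime => //; [exact: nonsquare_prime_exactly | | by rewrite oddM].
  rewrite coprimeMl coprime_sym prime_coprime // [coprime i _]coprime_sym prime_coprime //.
  rewrite !gtnNdvd //; case: (Q) Q_prime Q_odd => [|[|[|]]] //.
pose f (t : int * int * int) : int * int * int :=
  (q * t.1.1 - t.1.2 * j, t.1.2, form j q t).
pose g (t : int * int * int) : int * int * int :=
  (((t.1.1 + t.1.2 * j) %/ q)%Z, t.1.2,
   ((t.2 - 2 * t.1.1 * j - t.1.2 * j ^+ 2) %/ q ^+ 2)%Z).
have lift_eq t : liftable i t = (q %| t.1.1 + t.1.2 * j)%Z &&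
    (q ^+ 2 %| t.2 - 2 * t.1.1 * j - t.1.2 * j ^+ 2)%Z.
  by rewrite /liftable; congr ((_ %| _)%Z && _); rewrite /j; ring.
rewrite -[LHS]big_filter (@sum_bij _ _ _ s _ f g) ?filter_uniq ?triples_uniq //.
- apply: eq_bigr => t _; rewrite /W /weight /f /=; congr (c _ _ * _).
  rewrite /form /j !oddzD !oddzM oddzN.
  by rewrite /oddz /q /= Q_odd !andbF /= !andbT.
- move=> t; rewrite s_mem mem_filter mem_triples lift_eq => /and3P[/eqP det d0 f0].
  rewrite /f /= d0 f0 QN.
  have -> : q * t.1.1 - t.1.2 * j + t.1.2 * j = t.1.1 * q by ring.
  have e_eq : form j q t - 2 * (q * t.1.1 - t.1.2 * j) * j - t.1.2 * j ^+ 2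
      = t.2 * q ^+ 2 by rewrite /form; ring.
  rewrite e_eq (dvdz_mull _ (dvdzz q)) (dvdz_mull _ (dvdzz (q ^+ 2))); split.
    by apply/eqP; rewrite -det /form; ring.
  rewrite /g /= e_eq (_ : q * t.1.1 - t.1.2 * j + t.1.2 * j = t.1.1 * q); last by ring.
  by rewrite !mulzK //; case: (t) => [[]].
move=> [[u d] e]; rewrite mem_filter mem_triples lift_eq s_mem /f /g /=.
case/and4P=> /andP[/dvdzP[k uk] /dvdzP[l el]] d0 e0 /eqP; rewrite QN => det.
rewrite uk el !mulzK // d0.
have u_eq : u = k * q - d * j by rewrite -uk; ring.
have form_e : form j q (k, d, l) = e.
  rewrite /form /=; apply/eqP; rewrite -subr_eq0.
  have -> : - d * j ^+ 2 + 2 * k * j * q + l * q ^+ 2 - e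
    = (l * q ^+ 2 - (e - 2 * u * j - d * j ^+ 2))
      + 2 * j * (k * q - (u + d * j)) by ring.
  by rewrite uk el !subrr mulr0 addr0.
rewrite form_e e0; split; last by rewrite u_eq; congr (_, _, _); ring.
rewrite !andbT; apply/eqP/(mulfI q2_neq0); rewrite -det.
have -> : e = l * q ^+ 2 + 2 * u * j + d * j ^+ 2 by rewrite -el; ring.
by rewrite u_eq; ring.
Qed.

(** The substitution at infinity contributes the sum for [N] once, each of the [Q] others [Q^2]
    times. *)
Lemma parity_sum_hecke :
  parity_sum c (Q ^ 2 * N) = (1 + q ^+ 3) * parity_sum c N.
Proof.
have -> : parity_sum c (Q ^ 2 * N) = \sum_(t <- triples (Q ^ 2 * N)) W t.
  rewrite /parity_sum tsum_swap; apply: eq_bigr => t _.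
  by rewrite /W /weight c_sym.
transitivity (\sum_(t <- triples (Q ^ 2 * N) | (q ^+ 2 %| t.1.2)%Z) W t
    + \sum_(i < Q) \sum_(t <- triples (Q ^ 2 * N) | liftable i t) W t).
  have if_natz (b : bool) (x : int) : (if b then x else 0) = x * (b : nat)%:Z.
    by case: b; [exact: esym (mulr1 x) | exact: esym (mulr0 x)].
  rewrite (exchange_big_dep xpredT) //= [X in X + _]big_mkcond -big_split /=.
  apply: eq_big_seq => t /count_liftable count_t.
  transitivity (W t * ((q ^+ 2 %| t.1.2)%Z + \sum_(i < Q) liftable i t)%N%:Z).
    by rewrite count_t mulr1.
  rewrite [in RHS]big_mkcond PoszD mulrDr; congr (_ + _).
    by rewrite if_natz.
  rewrite (@big_morph _ _ Posz 0 +%R 0%N addn PoszD (erefl _)) mulr_sumr.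
  apply: eq_bigr => i _.
  by rewrite if_natz.
rewrite lift_infinity (eq_bigr (fun=> q ^+ 2 * parity_sum c N)); last first.
  by move=> i _; apply: lift_residue.
by rewrite sumr_const card_ord -mulr_natl natz -/q; ring.
Qed.

End Hecke.

(** * Non-square indices and the congruence modulo 7 *)

Definition sigma_class (a b : bool) : int :=
  if a && b then -3 else if a || b then 1 else -1.

(** The constant term of [sigma_series] contributes a coefficient of [theta], zero at non-squares;
    [sigma_class] is [sigma_weight] read on parities. *)
Lemma theta_sigma_nonsquare n : (forall l : int, l ^+ 2 <> n%:Z) ->
  (theta * sigma_series) n = 8 * parity_sum sigma_class n.
Proof.
move=> nsq; rewrite mulrDr mulr1 cfD theta_nonsquare // add0r theta_mul_lambert.
rewrite /parity_sum -tsumZ; apply: eq_tsum => u d e.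
by rewrite mulrA /sigma_class /sigma_weight /c4.
Qed.

Lemma dvd7_1addX3 Q :
    [\/ Q = 3 %[mod 7], Q = 5 %[mod 7] | Q = 6 %[mod 7]]%N ->
  (7 %| 1 + Q ^ 3)%N.
Proof.
by move=> Q7; rewrite /dvdn -modnDmr -modnXm; case: Q7 => ->.
Qed.

Local Close Scope ring_scope.

Theorem theorem1p3 (Q : nat) (Q_prime : prime Q)
    (Q_mod7 : [\/ Q = 3 %[mod 7], Q = 5 %[mod 7] | Q = 6 %[mod 7]])
    (n : nat) (n_gt0 : 0 < n) (n_coprime_Q : coprime n Q) :
  overpartition_number (7 * Q ^ 3 * n) = 0 %[mod 7].
Proof.
have Q_odd : odd Q.
  by case: (even_prime Q_prime) => // Q2; case: Q_mod7; rewrite Q2.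
have Qn : ~~ (Q %| n) by rewrite -prime_coprime // coprime_sym.
(* [Q^2] is set apart for the Hecke relation, applied to [Q * n], which [Q] divides exactly once. *)
pose m := Q ^ 2 * (Q * n).
have -> : 7 * Q ^ 3 * n = 7 * m by rewrite /m expnSr !mulnA.
have m_nsq (l : int) : (l ^+ 2 <> m%:Z)%R.
  move=> lm; have /dvdzP[k lk] : (Q %| l)%Z.
    by rewrite -dvdz_prime_sqr // lm PoszM dvdz_mulr // -mulnn PoszM dvdz_mulr.
  apply: (nonsquare_prime_exactly Q_prime Qn (l := k)).
  have Q2_neq0 : ((Q ^ 2)%N%:Z != 0)%R by rewrite eqz_nat -lt0n expn_gt0 prime_gt0.
  by apply: (mulfI Q2_neq0); rewrite -PoszM -/m -lm lk -mulnn PoszM; ring.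
have := theta_inv_mul7 m; rewrite theta_sigma_nonsquare // parity_sum_hecke //; last first.
  by move=> [] [].
have /dvdnP[k Qk] := dvd7_1addX3 Q_mod7.
have -> : (1 + Q%:Z ^+ 3)%R = (k%:Z * 7)%R.
  by have := congr1 Posz Qk; rewrite PoszD PoszM; lia.
have z7 : ((7 : int)%:~R = 0 :> 'F_7)%R by apply/eqP.
set P := parity_sum _ _.
have -> : (8 * (k%:Z * 7 * P) = 7 * (8 * k%:Z * P))%R by ring.
(* The sign relating [theta_inv] to the number of overpartitions is a unit modulo 7. *)
rewrite intrM z7 mul0r /theta_inv /= intrM => /eqP; rewrite mulf_eq0 => /orP[].
  by rewrite -signr_odd; case: (odd _).
have pchar7 : 7 \in [pchar 'F_7]%R by rewrite pchar_Fp.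
rewrite -pmulrn -(dvdn_pcharf pchar7) => /eqP pbar0.
by rewrite mod0n.
Qed.
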